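(* There is a Borel measurable bijection $\phi \colon C(I,Q)\to \mathsf{LC}(Q)$ such that $\phi(f)$ is homeomorphic to the image $f(I)$ of $f$ for every $f \in C(I,Q)$.
   Context: $I = [0,1]$ and $Q = I^{\mathbb{N}}$ is the Hilbert cube (product topology). A continuum is a nonempty compact connected metrizable space; a Peano continuum is a locally connected continuum. $\mathcal{K}(Q)$ is the space of all nonempty compact subsets of $Q$ with the Vietoris topology (equivalently, the topology of the Hausdorff metric), and $\mathsf{LC}(Q) \subseteq \mathcal{K}(Q)$ is the subspace of all Peano continua contained in $Q$. $C(I,Q)$ is the space of all continuous mappings from $I$ to $Q$ with the topology of uniform convergence. A mapping between topological spaces is Borel measurable if preimages of open sets are Borel. *)

(* Defs.v *)
From HB Require Import structures.
From mathcomp Require Import all_boot all_order all_algebra.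
From mathcomp Require Import all_classical all_reals all_analysis.

Set Implicit Arguments.
Unset Strict Implicit.
Unset Printing Implicit Defensive.

Import Order.TTheory GRing.Theory Num.Theory.
Import numFieldNormedType.Exports.

Local Open Scope classical_set_scope.
Local Open Scope ring_scope.

Definition homeomorphic (X Y : topologicalType) : Prop :=
  exists (f : X -> Y) (g : Y -> X),
    [/\ continuous f, continuous g, cancel f g & cancel g f].

(* [metricType R] requires the metric to induce the topology of its carrier. *)
Definition metrizable (R : realType) (X : topologicalType) : Prop :=
  exists M : metricType R, homeomorphic X M.

Definition continuum (R : realType) (X : topologicalType) : Prop :=
  [/\ [set: X] !=set0, compact [set: X], connected [set: X] & metrizable R X].

Definition locally_connected (X : topologicalType) : Prop :=
  forall (x : X) (U : set X), open U -> U x ->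
    exists V : set X, [/\ open V, V x, V `<=` U & connected V].

Definition peano_continuum (R : realType) (X : topologicalType) : Prop :=
  continuum R X /\ locally_connected X.

Definition borel_set (X : topologicalType) (A : set X) : Prop :=
  <<s (@open X) >> A.

Definition borel_measurable (X Y : topologicalType) (f : X -> Y) : Prop :=
  forall U : set Y, open U -> borel_set (f @^-1` U).

Section Hyperspace.
Variable X : topologicalType.

Definition hyperspace : Type :=
  set_type [set K : set X | K !=set0 /\ compact K].

HB.instance Definition _ := Choice.on hyperspace.

(* Subbase of the Vietoris topology, for U open in X:
   {K | K is contained in U} and {K | K meets U}, tagged true and false. *)
Definition vietoris_subbase (i : bool * set X) : set hyperspace :=
  if i.1 then [set K | set_val K `<=` i.2]
  else [set K | set_val K `&` i.2 !=set0].

HB.instance Definition _ := isSubBaseTopological.Build hyperspace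
  [set i : bool * set X | open i.2] vietoris_subbase.

End Hyperspace.

Definition unit_interval (R : realType) : Type := set_type `[0 : R, 1].

HB.instance Definition _ (R : realType) := Uniform.on (unit_interval R).

Definition hilbert_cube (R : realType) : Type :=
  {ptws nat -> unit_interval R}.

HB.instance Definition _ (R : realType) := Uniform.on (hilbert_cube R).

Definition path_space (R : realType) : Type :=
  initial_topology
    (id : continuousType (unit_interval R) (hilbert_cube R) ->
          {uniform unit_interval R -> hilbert_cube R}).

HB.instance Definition _ (R : realType) := Topological.on (path_space R).

(* For a set K, [set_type K] carries the subspace topology. *)
Definition peano_subcontinua (R : realType) : set (hyperspace (hilbert_cube R)) :=
  [set K | peano_continuum R (set_type (set_val K))].

Definition underlying (R : realType) (K : set_type (@peano_subcontinua R)) :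
    set (hilbert_cube R) :=
  set_val (set_val K).

Definition path_image (R : realType) (f : path_space R) :
    set (hilbert_cube R) :=
  range (f : continuousType (unit_interval R) (hilbert_cube R)).

(* Main.v *)
Require Import Defs.
From HB Require Import structures.
From mathcomp Require Import finmap.
From mathcomp Require Import all_boot all_order all_algebra.
From mathcomp Require Import all_classical all_reals all_analysis.
From mathcomp Require Import lra zify.

(** Two Borel maps run between paths and Peano continua in the Hilbert cube,
and both respect homeomorphism types.

The first one, [encode], sends a path g to the path t |-> (g t, c), where c is
the point of the cube that lists the coordinates of g at all rational times and
the pair is formed by interleaving coordinates. Its image g(I) x {c} is
homeomorphic to g(I), and every single point of it determines g: [decoder]
provides a Borel map that recovers g.

The second one, [image_section], is a section G of the continuous map im that
sends a path to its image: to every Peano continuum K it assigns a path with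
image exactly K, in such a way that G o im is Borel. It is the
Hahn-Mazurkiewicz theorem, made canonical. A finite sequence in a countable
dense set is read as a step function on [0, 1]; it approximates K up to e when
its consecutive terms are e-close, each term is e-close to K, and every point of
K is e-close to a term. Since K is uniformly locally connected and connected
sets contain arbitrarily fine chains between any two of their points, a
sufficiently fine approximation of K has refinements that approximate K
arbitrarily well and stay uniformly close to it ([extension], which rests on
[fine_refinement]). Choosing at every stage the first admissible refinement in a
fixed enumeration gives step functions that converge uniformly to a path with
image K ([limit_path], [peano_section]). Admissibility only says which open sets
K meets and which open sets contain K, and the limit lies in an open set of
paths iff some stage of the construction forces it to, so the selection is Borel
([selected_borel]). The decoder is built by the same selection.

The bijection is the Cantor-Schroeder-Bernstein map of the two injections. Put
h = G o im o encode, and let A be the set of the paths h^n(g) with g outside the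
range of G. A path g goes to the image of encode g if it is in A, and to its own
image otherwise. The two injections are inverted by im and by the decoder, so A
is cut out by equalities between Borel self-maps of the path space. Such
equalities define Borel sets ([borel_fixed]), which makes A, and with it the
bijection, Borel. *)

Set Implicit Arguments.
Unset Strict Implicit.
Unset Printing Implicit Defensive.

Import Order.TTheory GRing.Theory Num.Theory.
Import numFieldNormedType.Exports.

Local Open Scope classical_set_scope.
Local Open Scope ring_scope.

(** * A metric on the Hilbert cube *)

Section Dyadic.
Variable R : realType.

Definition ep (n : nat) : R := 2^-1 ^+ n.

Lemma ep_gt0 n : 0 < ep n. Proof. by rewrite exprn_gt0 // invr_gt0. Qed.

Lemma ep_ge0 n : 0 <= ep n. Proof. exact: ltW (ep_gt0 n). Qed.

Lemma epS n : ep n.+1 = ep n / 2. Proof. by rewrite /ep exprSr. Qed.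

Lemma ep0 : ep 0 = 1. Proof. by []. Qed.

Lemma ep_le m n : (m <= n)%N -> ep n <= ep m.
Proof.
move=> mn; apply: ler_wiXn2l => //; lra.
Qed.

Lemma ep_small (e : R) : 0 < e -> exists n, ep n < e.
Proof.
move=> e0; have [n /= _ hn] : \forall n \near \oo, ep n < e.
  have h : geometric 1 (2^-1 : R) @ \oo --> (0 : R).
    by apply: cvg_geometric; rewrite gtr0_norm ?invr_gt0 // invf_lt1 // ltr1n.
  move/cvgrPdist_lt : h => /(_ _ e0); apply: filterS => n.
  by rewrite /= sub0r normrN /geometric/= mul1r gtr0_norm // ep_gt0.
by exists n; apply: hn => /=.
Qed.

Lemma common_radius (T : eqType) (s : seq T) (P : T -> R -> Prop) :
  (forall p e e', e' <= e -> P p e -> P p e') ->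
  (forall p, p \in s -> exists2 e, 0 < e & P p e) ->
  exists2 e, 0 < e & forall p, p \in s -> P p e.
Proof.
move=> mono; elim: s => [_|p s ih h]; first by exists 1.
have [e e0 he] : exists2 e, 0 < e & forall q, q \in s -> P q e.
  by apply: ih => q qs; apply: h; rewrite inE qs orbT.
have [f f0 hf] := h p (mem_head _ _).
exists (Num.min e f); first by rewrite lt_min e0.
move=> q; rewrite inE => /orP[/eqP->|/he].
  by apply: mono hf; rewrite ge_min lexx orbT.
by apply: mono; rewrite ge_min lexx.
Qed.

End Dyadic.

Section CubeMetric.
Variable R : realType.
Local Notation Q := (hilbert_cube R).
Local Notation I := (unit_interval R).
Local Notation ep := (@ep R).

Definition ival (t : I) : R := set_val t.

Lemma ival_itv (t : I) : 0 <= ival t <= 1.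
Proof. by have := set_valP t; rewrite /= in_itv. Qed.

Lemma ival_inj : injective ival.
Proof. exact: val_inj. Qed.

Lemma ival_mem (x : R) : 0 <= x <= 1 -> x \in [set` `[0 : R, 1]].
Proof. by move=> h; apply: mem_set; rewrite /= in_itv. Qed.

Definition ilift (x : R) (h : 0 <= x <= 1) : I :=
  SigSub (ival_mem h).

Lemma iliftK x h : ival (@ilift x h) = x. Proof. by []. Qed.

Definition qterm (x y : Q) (k : nat) : R :=
  `|ival (x k) - ival (y k)| * ep k.+1.

Definition qdist (x y : Q) : R := sup (range (qterm x y)).

Lemma ival_dist (s t : I) : `|ival s - ival t| <= 1.
Proof.
by have := ival_itv s; have := ival_itv t; rewrite ler_norml; lra.
Qed.

Lemma qterm_ep x y k : qterm x y k <= ep k.+1.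
Proof. by rewrite ler_piMl // ?ival_dist ?ep_ge0. Qed.

(** The bound 1/2 leaves room below 1, the scale at which constructions start. *)
Lemma qterm_half x y k : qterm x y k <= 1 / 2.
Proof.
by rewrite (le_trans (qterm_ep _ _ _)) // (le_trans (ep_le _ (isT : 1 <= k.+1)%N)) // epS ep0.
Qed.

Lemma qterm_le x y k : qterm x y k <= qdist x y.
Proof.
apply: sup_upper_bound; last by exists k.
split; first by exists (qterm x y 0), 0%N.
by exists (1 / 2) => _ [j _ <-]; exact: qterm_half.
Qed.

Lemma qdist_le x y c : (forall k, qterm x y k <= c) -> qdist x y <= c.
Proof.
move=> h; apply: ge_sup; first by exists (qterm x y 0), 0%N.
by move=> _ [j _ <-].
Qed.

Lemma qdist_half x y : qdist x y <= 1 / 2.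
Proof. by apply: qdist_le => k; exact: qterm_half. Qed.

Lemma qdistxx x : qdist x x = 0.
Proof.
apply/eqP; rewrite eq_le; apply/andP; split.
  by apply: qdist_le => k; rewrite /qterm subrr normr0 mul0r.
by rewrite (le_trans _ (qterm_le x x 0)) // mulr_ge0 ?ep_ge0.
Qed.

Lemma qdist_sym x y : qdist x y = qdist y x.
Proof.
rewrite /qdist (_ : qterm x y = qterm y x) //.
by apply/funext => k; rewrite /qterm distrC.
Qed.

Lemma qdist_triangle y x z : qdist x z <= qdist x y + qdist y z.
Proof.
apply: qdist_le => k; apply: le_trans (lerD (qterm_le x y k) (qterm_le y z k)).
by rewrite -mulrDl ler_wpM2r ?ep_ge0 // ler_distD.
Qed.

Lemma qdist_eq0 x y : qdist x y = 0 -> x = y.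
Proof.
move=> h; suff xy k : x k = y k by exact: functional_extensionality_dep xy.
apply: ival_inj; have := qterm_le x y k; rewrite h /qterm pmulr_lle0 ?ep_gt0 //.
by rewrite normr_le0 subr_eq0 => /eqP.
Qed.

(** The weights make all coordinates from N on irrelevant at scale e. *)
Lemma qdist_lt_of x y e N : 0 < e -> ep N < e ->
  (forall k, (k < N)%N -> `|ival (x k) - ival (y k)| < e) -> qdist x y < e.
Proof.
move=> e0 Ne h; apply: le_lt_trans (_ : Num.max (ep N) (e / 2) < e); last first.
  by rewrite gt_max Ne /=; lra.
apply: qdist_le => k; rewrite le_max.
have [kN|Nk] := ltnP k N; apply/orP; [right|left]; last first.
  by rewrite (le_trans (qterm_ep _ _ _)) // ep_le // ltnW.
rewrite /qterm (le_trans (ler_wpM2r (ep_ge0 _ _) (ltW (h _ kN)))) //.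
by rewrite ler_pM2l // (le_trans (ep_le _ (isT : 1 <= k.+1)%N)) // epS ep0 mul1r.
Qed.

Local Notation qball := (fun x e => [set y | qdist x y < e]).

Lemma qdist_ge0 x y : 0 <= qdist x y.
Proof.
by rewrite (le_trans _ (qterm_le x y 0)) // mulr_ge0 ?ep_ge0.
Qed.

Lemma qball_center x e : 0 < e -> qball x e x.
Proof. by rewrite /= qdistxx. Qed.

Lemma qball_sym x y e : qball x e y -> qball y e x.
Proof. by rewrite /= qdist_sym. Qed.

Lemma qball_triangle x y z e1 e2 :
  qball x e1 y -> qball y e2 z -> qball x (e1 + e2) z.
Proof.
by move=> xy yz; apply: le_lt_trans (qdist_triangle y x z) (ltrD xy yz).
Qed.

Lemma entourage_I (A : set (I * I)) : entourage A ->
  exists2 e : R, 0 < e & forall s t : I, `|ival s - ival t| < e -> A (s, t).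
Proof.
move=> [B]; rewrite -entourage_ballE => -[e /= e0 eB] BA.
by exists e => // s t st; apply: BA; apply: eB.
Qed.

(** The product uniformity is the supremum of the uniformities pulled back along
the coordinates, so a condition on one coordinate is an entourage. *)
Lemma entourage_coord k e : 0 < e ->
  entourage [set xy : Q * Q | `|ival (xy.1 k) - ival (xy.2 k)| < e].
Proof.
move=> e0.
have h : `[< @entourage (initial_topology (@proj nat (fun=> I) k))
    [set xy | `|ival (xy.1 k) - ival (xy.2 k)| < e] >].
  apply/asboolP; exists [set xy : I * I | `|ival xy.1 - ival xy.2| < e] => //.
  rewrite -entourage_ballE; exists e => //.
eexists; last first.
  move=> xy; apply.
by match goal with |- finI_from _ ?f _ =>
  refine (@finI_from1 _ _ _ f (@exist _ _ (k, _) h) _) end.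
Qed.

(** One inclusion needs finitely many coordinates by [qdist_lt_of]; for the
other, an entourage of the product constrains finitely many coordinates. *)
Lemma qentourageE : entourage = entourage_ qball :> set_system (Q * Q).
Proof.
rewrite eqEsubset; split => A; last first.
  move=> [e /= e0 eA]; have [N Ne] := ep_small e0.
  apply: (filterS eA).
  have h : \forall xy \near entourage, forall k : 'I_N,
     `|ival ((xy : Q * Q).1 k) - ival (xy.2 k)| < e.
    by apply: filter_forall => k; exact: entourage_coord.
  apply: filterS h => -[x y] /= h; apply: (qdist_lt_of e0 Ne) => k kN.
  exact: (h (Ordinal kN)).
move=> [_ [F _ <-] FA].
have : forall p, p \in F ->
    exists2 e : R, 0 < e & forall x y : Q, qdist x y < e -> (projT1 p).2 (x, y).
  move=> -[[k B] /= Bent] _.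
  have /asboolP [C entC CB] := Bent.
  have [e e0 eC] := entourage_I entC.
  exists (e * ep k.+1); first by rewrite mulr_gt0 ?ep_gt0.
  move=> x y xy; apply: CB; apply: eC; rewrite -(ltr_pM2r (ep_gt0 R k.+1)).
  exact: le_lt_trans (qterm_le x y k) xy.
move=> h; have [p e e' ee' he x y xy|e e0 he] := common_radius _ h.
  exact: he (lt_le_trans xy ee').
exists e => // -[x y] /= xy; apply: FA => p pF; exact: he xy.
Qed.

End CubeMetric.

(* These instances refine the uniform structure already carried by the cube:
   [qentourageE] says that the metric induces it. *)
HB.instance Definition _ (R : realType) := Uniform_isPseudoMetric.Build R
  (hilbert_cube R) (@qball_center R) (@qball_sym R) (@qball_triangle R) (@qentourageE R).

HB.instance Definition _ (R : realType) := PseudoMetric_isMetric.Build R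
  (hilbert_cube R) (@qdist_ge0 R) (@qdist_eq0 R) (fun _ _ => erefl).

Section SubMetric.
Context (R : realType) (M : metricType R) (A : set M).

Let sdist (x y : A) := mdist (set_val x) (set_val y).

Let sdist_ge0 x y : 0 <= sdist x y. Proof. exact: mdist_ge0. Qed.

Let sdist_eq0 x y : sdist x y = 0 -> x = y.
Proof. by move/mdist_positivity/val_inj. Qed.

Let sballE x e : ball x e = [set y | sdist x y < e].
Proof.
rewrite -initial_ballE ballEmdist. done.
Qed.

HB.instance Definition _ := PseudoMetric_isMetric.Build R (set_type A)
  sdist_ge0 sdist_eq0 sballE.

End SubMetric.

HB.instance Definition _ (R : realType) := PseudoMetric.on (unit_interval R).

(** * Compact and connected sets in metric spaces *)

(** Lebesgue numbers in general: a radius that works near each point of a compact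
set can be chosen once for the whole set. *)
Lemma compact_uniform_radius (R : realType) (T : topologicalType) (K : set T)
    (P : R -> T -> Prop) : compact K ->
  (forall x, K x ->
    exists2 r0, 0 < r0 & \forall y \near x, forall r, r < r0 -> P r y) ->
  exists2 r, 0 < r & forall x, K x -> P r x.
Proof.
move=> /compact_near_coveringP cK h.
have [x Kx|r /= r_gt0 hr] := cK R 0^'+ P _.
  have [r0 r0_gt0 hx] := h x Kx.
  exists ([set y | forall r, r < r0 -> P r y], [set r | r < r0]).
    by split; [exact: hx|exact: nbhs_right_lt].
  by move=> [y r] /= [hy] /hy.
exists (r / 2); first by rewrite divr_gt0.
by apply: hr; rewrite /= ?sub0r ?normrN ?gtr0_norm ?divr_gt0 //; lra.
Qed.

Section MetricSpaces.
Context {R : realType} {M : metricType R}.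
Implicit Types (x y : M) (K C : set M).
Local Notation d := (@mdist R M).

Lemma nbhs_dist x (A : set M) :
  nbhs x A <-> exists2 e : R, 0 < e & forall y, d x y < e -> A y.
Proof.
split=> [/nbhs_ballP [e e0 eA]|[e e0 eA]].
  by exists e => // y xy; apply: eA; rewrite ballEmdist.
by apply/nbhs_ballP; exists e => // y; rewrite ballEmdist; exact: eA.
Qed.

Lemma open_dist x e : open [set y | d x y < e].
Proof.
rewrite openE => y /= xy; apply/nbhs_dist; exists (e - d x y); first by lra.
by move=> z yz /=; have := metric_triangle x y z; lra.
Qed.

Lemma open_dist_gt x c : open [set y | c < d y x].
Proof.
rewrite openE => y /= cy; apply/nbhs_dist.
exists (d y x - c); first by rewrite subr_gt0.
by move=> z yz /=; have := metric_triangle y z x; lra.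
Qed.

Lemma mdist_small_eq x y : (forall e, 0 < e -> d x y <= e) -> x = y.
Proof.
move=> h; apply: mdist_positivity; apply/eqP; rewrite eq_le mdist_ge0 andbT.
by apply/ler_addgt0Pl => e e0; rewrite addr0; exact: h.
Qed.

End MetricSpaces.

Section CompactMetric.
Context {R : realType} {M : metricType R}.
Implicit Types (x y : M) (K C : set M).
Local Notation d := (@mdist R M).

(** Points joined by a small connected subset of K; on a Peano continuum all
sufficiently close points are linked. *)
Definition linked K e x y := exists C,
  [/\ connected C, C x, C y, C `<=` K & forall z, C z -> d x z < e].

(** Total boundedness, by near-covering along the filter of the finite subsets of
K that contain a given one. *)
Lemma compact_net K e : compact K -> 0 < e ->
  exists2 s : seq M, (forall x, x \in s -> K x) &
    forall y, K y -> exists2 x, x \in s & d x y < e.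
Proof.
move=> /compact_near_coveringP cK e0.
pose inK (s : seq M) := forall x, x \in s -> K x.
pose F : set_system (seq M) :=
  filter_from inK (fun s => [set t : seq M | {subset s <= t} /\ inK t]).
have FF : Filter F.
  apply: filter_from_filter; first by exists [::].
  move=> s t sK tK; exists (s ++ t).
    by move=> x; rewrite mem_cat => /orP[/sK|/tK].
  by move=> u [stu uK]; split; split=> // x xs; apply: stu; rewrite mem_cat xs ?orbT.
have [y Ky|s sK hs] := cK _ F (fun s y => exists2 x, x \in s & d x y < e) FF.
  exists ([set z | d y z < e], [set t : seq M | {subset [:: y] <= t} /\ inK t]).
    split; last by exists [:: y] => // x; rewrite inE => /eqP->.
    by apply: open_nbhs_nbhs; split; [exact: open_dist|rewrite /= mdistxx].
  move=> [z t] /= [yz [yt _]]; exists y => //; exact: yt (mem_head _ _).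
by exists s; [exact: sK | exact: (hs s (conj (fun _ h => h) sK))].
Qed.

(** The points of C reachable from x by steps shorter than e form a subset that is
both open and closed in C. *)
Lemma connected_chain C x y e : connected C -> 0 < e -> C x -> C y ->
  exists p : seq M, [/\ path (fun u v => d u v < e) x p, last x p = y &
                        forall z, z \in p -> C z].
Proof.
move=> conC e0 Cx; pose B := [set y | exists p : seq M,
  [/\ path (fun u v => d u v < e) x p, last x p = y &
      forall z, z \in x :: p -> C z]].
have BC : B `<=` C by move=> z [p [_ <-]]; apply; exact: mem_last.
have Bext u v : B u -> C v -> d u v < e -> B v.
  move=> [p [xp pu pC]] Cv uv; exists (rcons p v); split.
  - by rewrite rcons_path xp pu.
  - by rewrite last_rcons.
  - by move=> z; rewrite -rcons_cons mem_rcons inE => /orP[/eqP->|/pC].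
suff BE : B = C.
  move=> Cy; have [p [xp py pC]] : B y by rewrite BE.
  exists p; split=> // z zp.
  by apply: pC; rewrite inE zp orbT.
apply: conC.
- by exists x, [::]; split=> // z; rewrite inE => /eqP ->.
- exists (\bigcup_(u in B) [set v | d u v < e]).
    by apply: bigcup_open => u _; exact: open_dist.
  rewrite eqEsubset; split=> [v Bv|v [Cv [u Bu uv]]]; last exact: Bext uv.
  by split; [exact: BC|exists v => //=; rewrite mdistxx].
- exists (~` \bigcup_(u in C `\` B) [set v | d u v < e]).
    by apply: open_closedC; apply: bigcup_open => u _; exact: open_dist.
  rewrite eqEsubset; split=> [v Bv|v [Cv nv]].
    split; first exact: BC.
    by move=> [u [Cu nBu] uv]; apply: nBu; apply: Bext Bv Cu _; rewrite metric_sym.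
  by apply: contrapT => nBv; apply: nv; exists v => //=; rewrite mdistxx.
Qed.

(** Every cluster point of u inherits all the bounds. *)
Lemma compact_limit (u : nat -> M) (c : nat -> R) : compact [set: M] ->
  (forall n m, (n <= m)%N -> d (u n) (u m) <= c n) ->
  exists l, forall n, d l (u n) <= c n.
Proof.
move=> cM uc; have [l [_ cl]] := cM (u @ \oo) _ filterT.
exists l => n; apply/ler_addgt0Pl => e e0.
have nb : nbhs l [set v | d l v < e].
  by apply/nbhs_dist; exists e.
have : (u @ \oo) [set u m | m in [set m | (n <= m)%N]].
  by exists n => // m /= nm; exists m.
move=> /cl /(_ nb) [_ [[m /= nm <-] /= lm]].
have := metric_triangle l (u m) (u n); have := uc _ _ nm.
rewrite (metric_sym (u n)); lra.
Qed.

Lemma compact_approx K x : compact K ->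
  (forall e, 0 < e -> exists2 y, K y & d x y < e) -> K x.
Proof.
move=> /(compact_closed (@metric_hausdorff R M)) clK h.
apply: clK => A /nbhs_dist[e e0 eA].
by have [y Ky xy] := h _ e0; exists y; split=> //; exact: eA.
Qed.

(** Compactness makes local connectedness uniform. *)
Lemma locally_connected_link K e : compact K -> locally_connected (set_type K) ->
  0 < e -> exists2 dl, 0 < dl & 
    forall x y, K x -> K y -> d x y < dl -> linked K e x y.
Proof.
move=> cK lc e0.
have [x Kx|dl dl0 hdl] := @compact_uniform_radius R M K
    (fun r x => K x -> forall y, K y -> d x y < r -> linked K e x y) cK; last first.
  by exists dl => // x y Kx; exact: hdl.
pose x' : set_type K := SigSub (mem_set Kx).
have e2 : d x x < e / 2 by rewrite mdistxx divr_gt0.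
have [V [oV Vx VU conV]] := lc x' _ (@open_dist R (set_type K) x' (e / 2)) e2.
pose C := set_val @` V.
have conC : connected C.
  apply: connected_continuous_connected conV _.
  exact/continuous_subspaceT/initial_continuous.
have CK : C `<=` K by move=> _ [z _ <-]; exact: set_valP.
have Cx z : C z -> d x z < e / 2 by move=> [w /VU ? <-].
have [r r0 hr] : exists2 r, 0 < r & forall y, K y -> d x y < r -> C y.
  have /nbhs_dist[r r0 hr] : nbhs x' V by exact: open_nbhs_nbhs.
  exists r => // y Ky xy; exists (SigSub (mem_set Ky)) => //; exact: hr.
exists (r / 2); first by rewrite divr_gt0.
apply/nbhs_dist; exists (r / 2); first by rewrite divr_gt0.
move=> y xy r' rr' Ky z Kz yz.
have Cy : C y by apply: hr => //; lra.
exists C; split=> //.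
- by apply: hr => //; have := metric_triangle x y z; lra.
- move=> w /Cx xw; have := Cx _ Cy; have := metric_triangle y x w.
  by rewrite (metric_sym y x); lra.
Qed.

End CompactMetric.

(** * Images of paths are Peano continua *)

Lemma compact_set_type (X : topologicalType) (A : set X) :
  compact A -> compact [set: set_type A].
Proof.
move=> cA F FF _; have [] := cA (set_val @ F) _ _.
  by apply: (@filterS _ F _ setT) filterT => x _; exact: set_valP.
move=> x [Ax clx]; exists (SigSub (mem_set Ax)); split=> //.
move=> B C FB [_ [[W oW <-] Wx WC]].
have [_ [[y By <-] Wy]] : (set_val @` B) `&` W !=set0.
  apply: clx; last by apply: open_nbhs_nbhs; split=> //.
  by apply: (@filterS _ F _ B) FB => y By; exists y.
by exists y; split=> //; exact: WC.
Qed.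

Section UnitInterval.
Variable R : realType.
Local Notation I := (unit_interval R).

Lemma nbhs_I (t : I) (A : set I) :
  nbhs t A <-> exists2 e : R, 0 < e & forall s, `|ival t - ival s| < e -> A s.
Proof. exact: nbhs_ballP. Qed.

Lemma clamp_itv (x : R) : 0 <= Num.max 0 (Num.min x 1) <= 1.
Proof. by rewrite le_max lexx /= ge_max ge_min lexx orbT ler01. Qed.

Definition clamp (x : R) : I := ilift (clamp_itv x).

Lemma clampK (t : I) : clamp (ival t) = t.
Proof.
apply: ival_inj; rewrite iliftK; have /andP[t0 t1] := ival_itv t.
by rewrite min_l // max_r.
Qed.

Lemma clamp_lip (x y : R) : `|ival (clamp x) - ival (clamp y)| <= `|x - y|.
Proof.
rewrite !iliftK /Num.max /Num.min /Order.max /Order.min.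
rewrite ler_norml; case: (ltP x 1) => ?; case: (ltP y 1) => ?;
  case: (ltP 0 x) => ?; case: (ltP 0 y) => ?; rewrite ?ltr01;
  have := ler_norm (x - y); have := ler_norm (y - x); rewrite (distrC y); lra.
Qed.

Lemma clamp_continuous : continuous clamp.
Proof.
move=> x A /nbhs_I [e e0 eA]; apply/nbhs_ballP; exists e => // y xy.
by apply: eA; apply: le_lt_trans xy; exact: clamp_lip.
Qed.

Lemma compact_I : compact [set: I].
Proof. exact/compact_set_type/segment_compact. Qed.

(** Retracting the line onto [0, 1] makes each ball of [0, 1] the image of an open
interval of the line. *)
Lemma connected_I_ball (t : I) (e : R) :
  connected [set s : I | `|ival t - ival s| < e].
Proof.
rewrite (_ : mkset _ = clamp @` `]ival t - e, ival t + e[).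
  apply: connected_continuous_connected.
    exact/connected_intervalP/interval_is_interval.
  exact/continuous_subspaceT/clamp_continuous.
rewrite eqEsubset; split=> [s /= ts|_ [x /= + <-]].
  exists (ival s); last exact: clampK.
  by rewrite /= in_itv /=; move: ts; rewrite ltr_norml; lra.
rewrite in_itv /= => xt; rewrite -[in X in X - _](clampK t).
by apply: le_lt_trans (clamp_lip _ _) _; rewrite ltr_norml; lra.
Qed.

Lemma connected_I : connected [set: I].
Proof.
have := @connected_I_ball (clamp 0) 2; rewrite (_ : mkset _ = setT) //.
rewrite eqEsubset; split=> // s _ /=.
by apply: le_lt_trans (ival_dist _ _) _; rewrite ltr1n.
Qed.

End UnitInterval.

Section PathImage.
Context {R : realType} {M : metricType R}.
Variable f : unit_interval R -> M.
Hypothesis fc : continuous f.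
Local Notation I := (unit_interval R).

Definition corestr (t : I) : set_type (range f) :=
  SigSub (mem_set (imageT f t)).

Lemma corestr_continuous : continuous corestr.
Proof. 
exact: (@continuous_comp_initial (set_type (range f)) I M set_val corestr fc). Qed.

Lemma corestr_surj : corestr @` [set: I] = [set: set_type (range f)].
Proof.
rewrite eqEsubset; split=> // y _; have [t _ ty] := set_valP y.
by exists t => //; exact: val_inj.
Qed.

Lemma compact_range : compact (range f).
Proof.
apply: continuous_compact (@compact_I R); exact: continuous_subspaceT.
Qed.

(** The preimage of a component V of an open set U is open, since a small interval
around t is mapped into U and hence into the component of f(t). As f is a closed
map onto its image, V is then open. *)
Lemma locally_connected_range : locally_connected (set_type (range f)).
Proof.
move=> y U oU Uy; pose V := connected_component U y.
have gc := corestr_continuous.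
have oV' : open (corestr @^-1` V).
  rewrite openE => t Vt.
  have Ut : U (corestr t) by exact: connected_component_sub Vt.
  have /nbhs_I[e e0 eU] : nbhs t (corestr @^-1` U).
    by apply: gc; exact: open_nbhs_nbhs.
  apply/nbhs_I; exists e => // s ts; apply: connected_component_trans Vt _.
  exists (corestr @` [set s : I | `|ival t - ival s| < e]); last by exists s.
  split.
  - by exists t => //=; rewrite subrr normr0.
  - by move=> _ [r /= /eU ? <-].
  - apply: connected_continuous_connected; first exact: connected_I_ball.
    exact: continuous_subspaceT.
exists V; split.
- (* V is the complement of the compact image of the closed set where f avoids V *)
  rewrite (_ : V = ~` (corestr @` ~` (corestr @^-1` V))).
    apply: closed_openC; apply: compact_closed; first exact: metric_hausdorff.
    apply: continuous_compact; first exact: continuous_subspaceT.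
    apply: subclosed_compact (@compact_I R) _ => //; exact: open_closedC.
  rewrite eqEsubset; split=> [z Vz [t /= nV tz]|z nz]; first by rewrite tz in nV.
  have [t _ tz] : (corestr @` [set: I]) z by rewrite corestr_surj.
  by apply: contrapT => nV; apply: nz; exists t; rewrite //= tz.
- exact: connected_component_refl.
- exact: connected_component_sub.
- exact: component_connected.
Qed.

Lemma metrizable_set_type (A : set M) : metrizable R (set_type A).
Proof. by exists (set_type A), id, id; split=> // x. Qed.

Lemma peano_range : peano_continuum R (set_type (range f)).
Proof.
split; last exact: locally_connected_range.
split; last exact: metrizable_set_type.
- by exists (corestr (clamp 0)).
- exact: compact_set_type compact_range.
- rewrite -corestr_surj; apply: connected_continuous_connected.
    exact: connected_I.
  exact/continuous_subspaceT/corestr_continuous.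
Qed.

End PathImage.

(** * The space of paths *)

Section PathSpace.
Variable R : realType.
Local Notation I := (unit_interval R).
Local Notation Q := (hilbert_cube R).
Local Notation X := (path_space R).
Local Notation d := (@mdist R Q).

Definition eval_path (g : X) : I -> Q := (g : continuousType I Q).

Definition mkpath (f : I -> Q) (fc : continuous f) : X := mkcts fc.

Lemma eval_mkpath f (fc : continuous f) : eval_path (mkpath fc) = f. Proof. by []. Qed.

Lemma eval_path_continuous g : continuous (eval_path g).
Proof. exact: cts_fun. Qed.

Lemma path_ext (g h : X) : eval_path g =1 eval_path h -> g = h.
Proof. by move=> gh; apply/continuousEP. Qed.

Lemma nbhs_path (g : X) (A : set X) :
  nbhs g A <-> exists2 e : R, 0 < e &
    forall h, (forall t, d (eval_path g t) (eval_path h t) < e) -> A h.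
Proof.
split=> [[_ [[W oW <-] Wg WA]]|[e e0 eA]].
  have /uniform_nbhs [E [entE EW]] : nbhs (g : {uniform I -> Q}) W.
    exact: open_nbhs_nbhs.
  move: entE; rewrite -entourage_ballE => -[e /= e0 eE].
  exists e => // h gh; apply: WA; apply: EW => t _.
  by apply: eE; rewrite /= ballEmdist; exact: (gh t).
have /(@initial_continuous (continuousType I Q) {uniform I -> Q} id) : nbhs (g : {uniform I -> Q})
    [set h | forall t, d (eval_path g t) (h t) < e].
  apply/uniform_nbhs; exists [set xy | d xy.1 xy.2 < e]; split.
    rewrite -entourage_ballE; exists e => // xy /=; by rewrite ballEmdist.
  by move=> k /= gk t; exact: (gk t).
move=> gh; have : nbhs g [set h : X | forall t, d (eval_path g t) (eval_path h t) < e] by exact: gh.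
by apply: filterS => h; exact: eA.
Qed.

Lemma evaluation_continuous t : continuous (fun g : X => eval_path g t).
Proof.
move=> g A /nbhs_dist[e e0 eA]; apply/nbhs_path; exists e => // h gh.
exact: eA (gh t).
Qed.

End PathSpace.

(** * Step functions and their limits *)

Section Subdivision.
Variable R : realType.
Local Notation I := (unit_interval R).

(** The index of the piece containing t when [0, 1] is cut into m equal pieces;
the minimum puts t = 1 in the last piece. *)
Definition idx (m : nat) (t : I) : nat := minn (Num.truncn (ival t * m%:R)) m.-1.

Lemma idx_lt m t : (0 < m)%N -> (idx m t < m)%N.
Proof. by rewrite /idx; lia. Qed.

Lemma idx_itv m t : (0 < m)%N ->
  (idx m t)%:R <= ival t * m%:R <= (idx m t).+1%:R.
Proof.
move=> m0; have /andP[t0 t1] := ival_itv t.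
have tm0 : 0 <= ival t * m%:R by rewrite mulr_ge0.
have /andP[h1 h2] := truncn_itv tm0.
have tm : ival t * m%:R <= m%:R by rewrite ler_piMl.
rewrite /idx; have [h|h] := leqP (Num.truncn (ival t * m%:R)) m.-1.
  by rewrite h1 ltW.
rewrite prednK // tm andbT; apply: le_trans h1; rewrite ler_nat; exact: ltnW.
Qed.

Lemma idx_eq m t i : (i < m)%N -> i%:R <= ival t * m%:R ->
  ival t * m%:R < i.+1%:R \/ i.+1 = m -> idx m t = i.
Proof.
move=> im it h; have /andP[t0 t1] := ival_itv t.
have tm0 : 0 <= ival t * m%:R by rewrite mulr_ge0.
have /andP[h1 h2] := truncn_itv tm0.
have it' : (i <= Num.truncn (ival t * m%:R))%N.
  by have := le_lt_trans it h2; rewrite ltr_nat ltnS.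
rewrite /idx; case: h => [h|h]; last by subst m; apply/minn_idPr.
have := le_lt_trans h1 h; rewrite ltr_nat; lia.
Qed.

(** Cutting each of m pieces into k smaller ones: the parent of piece j is piece
j %/ k. *)
Lemma idx_div m k t : (0 < m)%N -> (0 < k)%N -> (idx (m * k) t %/ k)%N = idx m t.
Proof.
move=> m0 k0; have mk0 : (0 < m * k)%N by rewrite muln_gt0 m0.
have /andP[t0 t1] := ival_itv t.
have tm0 : 0 <= ival t * m%:R by rewrite mulr_ge0.
have k0' : 0 < k%:R :> R by rewrite ltr0n.
rewrite /idx natrM mulrA; set T := Num.truncn (_ * k%:R).
have /andP[h1 h2] := truncn_itv (mulr_ge0 tm0 (ltW k0')).
have -> : Num.truncn (ival t * m%:R) = (T %/ k)%N.
  apply: truncn_def; rewrite -(ler_pM2r k0') -(ltr_pM2r k0') -!natrM.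
  rewrite (le_trans _ h1) ?ler_nat ?leq_divM //=.
  by rewrite (lt_le_trans h2) // ler_nat -/T ltn_ceil.
have mk1 : ((m * k).-1 %/ k = m.-1)%N.
  apply/eqP; rewrite eqn_leq -ltnS prednK // ltn_divLR // prednK // leqnn /=.
  by rewrite leq_divRL //; nia.
have [TT|TT] := leqP T (m * k).-1.
  by rewrite (minn_idPl _) // -mk1 leq_div2r.
by rewrite mk1 (minn_idPr _) // -mk1 leq_div2r // ltnW.
Qed.

(** Hence parameters at distance less than 1/m lie in equal or adjacent pieces. *)
Lemma idx_near m s t : (0 < m)%N -> `|ival t - ival s| < m%:R^-1 ->
  (idx m s <= (idx m t).+1)%N.
Proof.
move=> m0 ts; have /andP[_ ht] := idx_itv t m0; have /andP[hs _] := idx_itv s m0.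
have m0' : 0 < m%:R :> R by rewrite ltr0n.
have h : ival s * m%:R < ival t * m%:R + 1.
  rewrite -(ltr_pM2r m0') mulVf ?gt_eqF // in ts.
  have := ler_norm (ival s - ival t); rewrite distrC -(ler_pM2r m0'); lra.
rewrite -ltnS -(ltr_nat R); rewrite -[X in _ < X]natr1; lra.
Qed.

Definition node (m i : nat) : I := clamp (i%:R / m%:R).

Lemma ival_node m i : (i <= m)%N -> (0 < m)%N -> ival (node m i) = i%:R / m%:R.
Proof.
move=> im m0; have m0' : 0 < m%:R :> R by rewrite ltr0n.
rewrite iliftK min_l; last by rewrite ler_pdivrMr // mul1r ler_nat.
by rewrite max_r // divr_ge0.
Qed.

Lemma idx_node m i : (i < m)%N -> idx m (node m i) = i.
Proof.
move=> im; have m0 : (0 < m)%N by lia.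
have m0' : m%:R != 0 :> R by rewrite pnatr_eq0 -lt0n.
by apply: idx_eq => //; rewrite ival_node ?(ltnW im) // divfK //; left; rewrite ltr_nat.
Qed.

Lemma node_near m t : (0 < m)%N -> `|ival t - ival (node m (idx m t))| <= m%:R^-1.
Proof.
move=> m0; have m0' : 0 < m%:R :> R by rewrite ltr0n.
rewrite ival_node ?(ltnW (idx_lt _ _)) //.
have /andP[] := idx_itv t m0; rewrite -(ler_pdivrMr _ _ m0') -(ler_pdivlMr _ _ m0').
rewrite -[(idx m t).+1%:R]natr1 mulrDl mul1r ler_norml.
by have : 0 < m%:R^-1 :> R by [rewrite invr_gt0]; lra.
Qed.

End Subdivision.

Section StepFunctions.
Context {R : realType} {M : metricType R}.
Variable x0 : M.
Local Notation I := (unit_interval R).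
Local Notation d := (@mdist R M).
Local Notation ep := (@ep R).
Implicit Types (w : seq M).

Definition step_path w (t : I) : M := nth x0 w (idx (size w) t).

(** Each term of w is replaced by a block of k terms within e of it. Blocks have
equal lengths so that [idx_div] relates the two subdivisions. *)
Definition refines (e : R) w w' := exists2 k, (0 < k)%N & size w' = (size w * k)%N /\
  forall j, (j < size w')%N -> d (nth x0 w' j) (nth x0 w (j %/ k)) < e.

Definition mesh (e : R) w := forall i, (i.+1 < size w)%N ->
  d (nth x0 w i) (nth x0 w i.+1) < e.

Lemma refines_step_path e w w' t : (0 < size w)%N -> refines e w w' ->
  d (step_path w' t) (step_path w t) < e.
Proof.
move=> w0 [k k0 [sw' h]]; rewrite /step_path -(@idx_div _ (size w) k) // -sw'; apply: h.
by rewrite idx_lt // sw' muln_gt0 w0.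
Qed.

Lemma mesh_step_path e w s t : 0 < e -> (0 < size w)%N -> mesh e w ->
  `|ival t - ival s| < (size w)%:R^-1 -> d (step_path w t) (step_path w s) < e.
Proof.
move=> e0 w0 mw ts.
have h1 := idx_near w0 ts; have h2 : (idx (size w) t <= (idx (size w) s).+1)%N.
  by apply: idx_near => //; rewrite distrC.
rewrite /step_path; have := idx_lt s w0; have := idx_lt t w0.
move: (idx _ s) (idx _ t) h1 h2 => i j h1 h2 jw iw.
have [->|[ij|ij]] : i = j \/ i = j.+1 \/ j = i.+1 by lia.
- by rewrite mdistxx.
- by rewrite ij in iw *; exact: mw.
- by rewrite ij in jw *; rewrite metric_sym; exact: mw.
Qed.

(** Successive step functions differ by less than ep n, so they converge
uniformly with error 2 * ep n. The mesh condition bounds the jumps, which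
vanish in the limit, and so the limit is continuous. *)
Lemma limit_path (w : nat -> seq M) : compact [set: M] ->
  (forall n, (0 < size (w n))%N) -> (forall n, refines (ep n) (w n) (w n.+1)) ->
  (forall n, mesh (2 * ep n) (w n)) ->
  exists2 f : I -> M, continuous f & forall n t, d (f t) (step_path (w n) t) <= 2 * ep n.
Proof.
move=> cM w0 wr wm.
have step n t : d (step_path (w n) t) (step_path (w n.+1) t) <= ep n.
  by rewrite metric_sym ltW //; exact: refines_step_path.
have tel t n m : (n <= m)%N -> d (step_path (w n) t) (step_path (w m) t) <= 2 * (ep n - ep m).
  elim: m => [|m ih]; first by rewrite leqn0 => /eqP->; rewrite mdistxx subrr mulr0.
  rewrite leq_eqVlt => /orP[/eqP->|]; first by rewrite mdistxx subrr mulr0.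
  rewrite ltnS => /ih h; have := metric_triangle (step_path (w n) t) (step_path (w m) t) (step_path (w m.+1) t).
  by have := step m t; rewrite [in X in _ -> _ -> X]epS; lra.
have /choice [f hf] : forall t, exists l, forall n, d l (step_path (w n) t) <= 2 * ep n.
  move=> t; apply: compact_limit => // n m nm; apply: le_trans (tel t n m nm) _.
  by have := ep_gt0 R m; lra.
exists f => // t A /nbhs_dist[e e0 eA].
have [n ne] := ep_small (divr_gt0 e0 (ltr0n R 6)).
apply/nbhs_I; exists (size (w n))%:R^-1; first by rewrite invr_gt0 ltr0n.
move=> s ts; apply: eA.
have := mesh_step_path _ (w0 n) (wm n) ts; rewrite mulr_gt0 ?ep_gt0 // => /(_ isT).
have := hf t n; have := hf s n; rewrite (metric_sym (f s)).
have := metric_triangle (f t) (step_path (w n) t) (f s).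
have := metric_triangle (step_path (w n) t) (step_path (w n) s) (f s).
by lra.
Qed.

End StepFunctions.

Lemma compact_Q (R : realType) : compact [set: hilbert_cube R].
Proof.
have := @tychonoff nat (fun=> unit_interval R) (fun=> setT) (fun=> @compact_I R).
by rewrite (_ : mkset _ = setT) // eqEsubset.
Qed.

Lemma dense_seq (R : realType) (M : metricType R) : compact [set: M] -> M ->
  exists D : nat -> M, forall x e, 0 < e -> exists n, mdist x (D n) < e.
Proof.
move=> cM x0.
have /choice [s hs] : forall n, exists s : seq M,
    forall y, exists2 x, x \in s & mdist y x < ep R n.
  move=> n; have [s _ hs] := compact_net cM (ep_gt0 R n); 
  exists s => y; have [x xs xy] := hs y Logic.I.
  by exists x; rewrite // metric_sym.
exists (fun a : nat => let nj := odflt (0%N, 0%N) (unpickle a) in nth x0 (s nj.1) nj.2).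
move=> x e e0; have [n ne] := ep_small e0; have [y ys xy] := hs n x.
exists (pickle (n, index y (s n))); rewrite pickleK /= nth_index //; exact: lt_trans ne.
Qed.

(** * Refining approximations of a Peano continuum *)

Section Refinement.
Context {R : realType} {M : metricType R}.
Variable x0 : M.
Implicit Types (K : set M) (w v : seq M).
Local Notation d := (@mdist R M).
Local Notation refines := (refines x0).
Local Notation mesh := (mesh x0).
Local Notation chain e := (path (fun a b : M => d a b < e)).

(** A fine walk from a that visits all of s and comes back, never leaving the
connected sets that join a to the points of s. *)
Lemma loop_through K (e eta : R) a (s : seq M) : 0 < e ->
  (forall y, y \in s -> linked K eta a y) ->
  exists p : seq M, [/\ chain e a p, last a p = a,
    forall z, z \in p -> K z /\ d a z < eta & {subset s <= a :: p}].
Proof.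
move=> e0; elim: s => [_|y s ih h]; first by exists [::].
have [p [ap pa pK sp]] : exists p : seq M, [/\ chain e a p, last a p = a,
    forall z, z \in p -> K z /\ d a z < eta & {subset s <= a :: p}].
  by apply: ih => z zs; apply: h; rewrite inE zs orbT.
have [C [conC Ca Cy CK Ce]] := h y (mem_head _ _).
have [q [aq qy qC]] := connected_chain conC e0 Ca Cy.
have [r [yr ra rC]] := connected_chain conC e0 Cy Ca.
exists (q ++ r ++ p); split.
- by rewrite !cat_path aq qy yr ra.
- by rewrite !last_cat qy ra.
- by move=> z; rewrite !mem_cat => /or3P[/qC Cz|/rC Cz|/pK//]; split; auto.
- move=> z; rewrite inE => /orP[/eqP->|/sp].
    by rewrite -cat_cons mem_cat -{1}qy mem_last.
  by rewrite !inE !mem_cat => /orP[->//|->]; rewrite !orbT.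
Qed.

(** The block of w_i is a fine walk that starts at w_i, visits the points of a
fine net of K linked to w_i and ends at w_(i+1). All its points lie in connected
sets of size eta around w_i, whence the refinement; together the blocks visit the
whole net, whence the covering of K. *)
Lemma fine_refinement K w (e eta : R) : compact K -> 0 < e -> 0 < eta ->
  (0 < size w)%N -> (forall i, (i < size w)%N -> K (nth x0 w i)) ->
  (forall i, (i.+1 < size w)%N -> linked K eta (nth x0 w i) (nth x0 w i.+1)) ->
  (forall y, K y -> exists2 i, (i < size w)%N & linked K eta (nth x0 w i) y) ->
  exists v, [/\ refines eta w v, mesh e v,
    forall j, (j < size v)%N -> K (nth x0 v j) &
    forall y, K y -> exists2 j, (j < size v)%N & d y (nth x0 v j) < e].
Proof.
move=> cK e0 eta0 w0 wK wl wcov.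
have [s sK scov] := compact_net cK e0.
have block i : exists p : seq M, (i < size w)%N ->
  [/\ chain e (nth x0 w i) p,
      forall z, z \in p -> K z /\ d (nth x0 w i) z < eta,
      forall y, y \in s -> linked K eta (nth x0 w i) y -> y \in nth x0 w i :: p &
      (i.+1 < size w)%N -> last (nth x0 w i) p = nth x0 w i.+1].
  set a := nth x0 w i.
  have [p [ap pa pK sp]] : exists p : seq M, [/\ chain e a p, last a p = a,
      forall z, z \in p -> K z /\ d a z < eta &
      {subset [seq y <- s | `[< linked K eta a y >]] <= a :: p}].
    by apply: loop_through => // y; rewrite mem_filter => /andP[/asboolP].
  have sp' y : y \in s -> linked K eta a y -> y \in a :: p.
    by move=> ys ay; apply: sp; rewrite mem_filter ys andbT; apply/asboolP.
  have [iw|iw] := ltnP i.+1 (size w); last by exists p.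
  have [C [conC Ca Cy CK Ce]] := wl i iw.
  have [q [aq qy qC]] := connected_chain conC e0 Ca Cy.
  exists (p ++ q) => _; split.
  - by rewrite cat_path ap pa.
  - by move=> z; rewrite mem_cat => /orP[/pK//|/qC Cz]; split; auto.
  - by move=> y ys /(sp' _ ys); rewrite !inE mem_cat => /orP[->//|->]; rewrite orbT.
  - by rewrite last_cat pa.
have /choice [p hp] := block.
pose k := (\max_(i < size w) size (p i)).+1.
(* repeating the first point gives all blocks the common length k, which exceeds
   the size of every walk, so that each block still starts at its base point *)
pose blk i := nseq (k - size (p i)) (nth x0 w i) ++ p i.
have pk i : (i < size w)%N -> (size (p i) < k)%N.
  by move=> iw; rewrite ltnS; exact: (leq_bigmax (Ordinal iw)).
have sblk i : (i < size w)%N -> size (blk i) = k.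
  by move=> iw; rewrite size_cat size_nseq subnK // ltnW // pk.
have blk0 i : (i < size w)%N -> nth x0 (blk i) 0 = nth x0 w i.
  by move=> iw; have := pk _ iw; rewrite -subn_gt0 /blk; case: (k - _)%N.
have memblk i : (i < size w)%N -> blk i =i nth x0 w i :: p i.
  move=> iw z; rewrite mem_cat inE mem_nseq.
  by have := pk _ iw; rewrite -subn_gt0 => ->.
have chblk i : (i < size w)%N -> chain e (nth x0 w i) (blk i).
  move=> iw; have [ap _ _ _] := hp i iw; rewrite cat_path.
  have -> n : last (nth x0 w i) (nseq n (nth x0 w i)) = nth x0 w i by elim: n.
  rewrite ap andbT; elim: (_ - _)%N => //= n ->.
  by rewrite mdistxx e0.
have lblk i : (i.+1 < size w)%N -> last (nth x0 w i) (blk i) = nth x0 w i.+1.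
  move=> iw; have [_ _ _ lp] := hp i (ltnW iw); rewrite last_cat -lp //.
  by congr (last _ _); elim: (_ - _)%N.
have k0 : (0 < k)%N by [].
pose v := mkseq (fun j => nth x0 (blk (j %/ k)%N) (j %% k)) (size w * k).
have sv : size v = (size w * k)%N by rewrite size_mkseq.
have nv j : (j < size v)%N -> nth x0 v j = nth x0 (blk (j %/ k)%N) (j %% k).
  by rewrite sv => jv; rewrite nth_mkseq.
have dv j : (j < size v)%N -> (j %/ k < size w)%N by rewrite sv ltn_divLR.
have inblk j : (j < size v)%N -> nth x0 v j \in nth x0 w (j %/ k) :: p (j %/ k)%N.
  move=> jv; rewrite -memblk ?dv // nv // mem_nth // sblk ?dv //.
  by rewrite ltn_mod.
have vin j : (j < size v)%N -> K (nth x0 v j) /\ d (nth x0 w (j %/ k)) (nth x0 v j) < eta.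
  move=> jv; have [_ pin _ _] := hp _ (dv _ jv); have := inblk _ jv; rewrite inE.
  by case/orP=> [/eqP->|/pin//]; rewrite mdistxx; split=> //; exact: wK (dv _ jv).
exists v; split.
- by exists k => //; split=> // j jv; rewrite metric_sym; case: (vin j jv).
- move=> j jv; have jv' := ltnW jv; rewrite !nv //.
  (* either j is the end of its block, which is the start of the next one, or j
     and j+1 lie in the same walk *)
  have jE : j.+1 = (j %/ k * k + (j %% k).+1)%N by rewrite addnS -divn_eq.
  have [jk|jk] := eqVneq (j %% k).+1 k.
    have ej : (j.+1 %/ k)%N = (j %/ k).+1.
      by rewrite jE jk -mulSnr mulnK.
    have ej0 : (j.+1 %% k = 0)%N.
      by rewrite jE jk -mulSnr modnMl.
    have iw : ((j %/ k).+1 < size w)%N by rewrite -ej dv.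
    rewrite ej ej0 blk0 // -lblk // -nth_last sblk ?dv // -[k in k.-1]jk /=.
    rewrite (set_nth_default (nth x0 w (j %/ k))) ?mdistxx // sblk ?dv //.
    by rewrite ltn_mod.
  have jk' : ((j %% k).+1 < k)%N by rewrite ltn_neqAle jk ltn_mod.
  have ej : (j.+1 %/ k = j %/ k)%N.
    by rewrite jE divnMDl // (divn_small jk') addn0.
  have ej0 : (j.+1 %% k = (j %% k).+1)%N.
    by rewrite jE modnMDl modn_small.
  rewrite ej ej0; have /(pathP x0) /(_ (j %% k).+1) := chblk _ (dv _ jv').
  by rewrite sblk ?dv //; exact.
- by move=> j /vin[].
- move=> y /scov[u us uy]; have [i iw iu] := wcov _ (sK _ us).
  have [_ _ sp _] := hp _ iw; have := sp _ us iu; rewrite -memblk // => ub.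
  have ik : (index u (blk i) < k)%N by rewrite -(sblk i) // index_mem.
  have jv : (i * k + index u (blk i) < size v)%N by rewrite sv; nia.
  exists (i * k + index u (blk i))%N => //.
  rewrite nv // divnMDl // divn_small // addn0 modnMDl modn_small //.
  by rewrite nth_index // metric_sym.
Qed.

(** For K compact, the last two conditions say which open sets K meets and in
which open sets it is contained. *)
Definition approximates e w K := [/\ (0 < size w)%N, mesh e w,
  forall j, (j < size w)%N -> exists2 y, K y & d (nth x0 w j) y < e &
  forall y, K y -> exists2 j, (j < size w)%N & d y (nth x0 w j) < e].

Variable D : nat -> M.
Hypothesis Ddense : forall x e, 0 < e -> exists n, d x (D n) < e.

Lemma perturb v (e : R) : 0 < e -> exists2 z : seq nat, size z = size v &
  forall j, (j < size v)%N -> d (nth x0 v j) (nth x0 (map D z) j) < e.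
Proof.
move=> e0; have /choice[g hg] : forall x, exists n, d x (D n) < e by move=> x; exact: Ddense.
exists (map g v); first by rewrite size_map.
by move=> j jv; rewrite (nth_map 0%N) ?size_map // (nth_map x0).
Qed.

(** The chain has half of the precision e; the other half pays for moving its
points into the dense sequence. *)
Lemma perturb_chain K v (e t : R) : 0 < e -> 0 < t -> (0 < size v)%N ->
  mesh (e / 2) v -> (forall j, (j < size v)%N -> K (nth x0 v j)) ->
  (forall y, K y -> exists2 j, (j < size v)%N & d y (nth x0 v j) < e / 2) ->
  exists z : seq nat, [/\ size z = size v, approximates e (map D z) K &
    forall j, (j < size v)%N -> d (nth x0 v j) (nth x0 (map D z) j) < t].
Proof.
move=> e0 t0 v0 mv vK vcov.
have m0 : 0 < Num.min t (e / 4) by rewrite lt_min t0 divr_gt0.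
have [z sz hz] := perturb v m0; exists z.
have zt j : (j < size v)%N -> d (nth x0 v j) (nth x0 (map D z) j) < t.
  by move=> /hz; rewrite lt_min => /andP[].
have ze j : (j < size v)%N -> d (nth x0 v j) (nth x0 (map D z) j) < e / 4.
  by move=> /hz; rewrite lt_min => /andP[].
split=> //; split; rewrite ?size_map ?sz //.
- move=> j; rewrite size_map sz => jv; have := mv j jv.
  have := ze _ jv; have := ze _ (ltnW jv).
  set a := nth x0 v j; set b := nth x0 v j.+1.
  set a' := nth x0 _ j; set b' := nth x0 _ j.+1.
  have := metric_triangle a' a b'; have := metric_triangle a b b'.
  rewrite (metric_sym a' a); lra.
- move=> j jv; exists (nth x0 v j); first exact: vK.
  by rewrite metric_sym; have := ze _ jv; lra.
- move=> y /vcov[j jv yj]; exists j => //; have := ze _ jv.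
  have := metric_triangle y (nth x0 v j) (nth x0 (map D z) j); lra.
Qed.

(** Replacing the terms of w by nearby points of K gives points whose neighbours
are closer than the modulus of local connectedness, hence linked in K, and
[fine_refinement] applies. The precision eta is shared: eta/4 for moving w into K,
eta/2 for the walks, eta/4 for moving the result into the dense sequence. *)
Lemma extension K (eta : R) : compact K -> locally_connected (set_type K) ->
  0 < eta -> exists2 dl : R, 0 < dl & forall e w, e < dl -> approximates e w K ->
  forall e', 0 < e' ->
    exists2 z : seq nat, refines eta w (map D z) & approximates e' (map D z) K.
Proof.
move=> cK lK eta0.
have [dl dl0 hdl] := locally_connected_link cK lK (divr_gt0 eta0 (ltr0n R 2)).
exists (Num.min (dl / 3) (eta / 4)); first by rewrite lt_min !divr_gt0.
move=> e w; rewrite lt_min => /andP[edl eeta] [w0 mw wK wcov] e' e'0.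
have /choice[f hf] : forall j, exists y, (j < size w)%N -> K y /\ d (nth x0 w j) y < e.
  move=> j; have [jw|jw] := ltnP j (size w); last by exists x0.
  by have [y Ky jy] := wK j jw; exists y.
pose x := mkseq f (size w).
have sx : size x = size w by rewrite size_mkseq.
have nx j : (j < size w)%N -> nth x0 x j = f j by move=> jw; rewrite nth_mkseq.
have [v [rv mv vK vcov]] : exists v, [/\ refines (eta / 2) x v, mesh (e' / 2) v,
    forall j, (j < size v)%N -> K (nth x0 v j) &
    forall y, K y -> exists2 j, (j < size v)%N & d y (nth x0 v j) < e' / 2].
  apply: fine_refinement; rewrite ?divr_gt0 ?sx //.
  - by move=> i iw; rewrite nx //; case: (hf i iw).
  - move=> i iw; rewrite !nx ?(ltnW iw) //.
    have [Ki wi] := hf i (ltnW iw); have [Ki' wi'] := hf i.+1 iw.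
    apply: hdl => //; have := mw i iw.
    have := metric_triangle (f i) (nth x0 w i) (f i.+1).
    have := metric_triangle (nth x0 w i) (nth x0 w i.+1) (f i.+1).
    rewrite (metric_sym (f i) (nth x0 w i)); lra.
  - move=> y Ky; have [i iw yi] := wcov y Ky; exists i => //; rewrite nx //.
    have [Ki wi] := hf i iw; apply: hdl => //.
    have := metric_triangle (f i) (nth x0 w i) y.
    rewrite (metric_sym (f i) (nth x0 w i)) (metric_sym (nth x0 w i) y); lra.
have [k k0 [sv hv]] := rv.
have v0 : (0 < size v)%N by rewrite sv sx muln_gt0 w0.
have [z [sz az zv]] := perturb_chain e'0 (divr_gt0 eta0 (ltr0n R 4)) v0 mv vK vcov.
exists z => //; exists k => //; rewrite size_map sz; split; first by rewrite sv sx.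
move=> j jv; have jk : (j %/ k < size w)%N by rewrite ltn_divLR // -sx -sv.
have := zv j jv; have := hv j jv; rewrite nx //; have [_] := hf _ jk.
set a := nth x0 (map D z) j; set b := nth x0 v j; set c' := nth x0 w _; set c := f _.
have := metric_triangle a b c'; have := metric_triangle b c c'.
rewrite (metric_sym a b) (metric_sym c c'); lra.
Qed.

(** At a scale exceeding the diameter, K itself links all of its points. *)
Lemma extension_start K (eta : R) (a : M) : compact K -> connected K ->
  K !=set0 -> (forall x y, d x y < eta) -> forall e', 0 < e' ->
  exists2 z : seq nat, refines eta [:: a] (map D z) & approximates e' (map D z) K.
Proof.
move=> cK conK [b Kb] eta_diam e' e'0.
have eta0 : 0 < eta by have := eta_diam b b; rewrite mdistxx.
have [v [[k k0 [sv _]] mv vK vcov]] : exists v, [/\ refines eta [:: b] v, mesh (e' / 2) v,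
    forall j, (j < size v)%N -> K (nth x0 v j) &
    forall y, K y -> exists2 j, (j < size v)%N & d y (nth x0 v j) < e' / 2].
  apply: fine_refinement; rewrite ?divr_gt0 //.
  - by case.
  - by move=> y Ky; exists 0%N => //; exists K; split=> // z _; exact: eta_diam.
have v0 : (0 < size v)%N by rewrite sv muln_gt0.
have [z [sz az zv]] := perturb_chain e'0 eta0 v0 mv vK vcov.
by exists z => //; exists k; rewrite ?size_map ?sz.
Qed.

End Refinement.

(** * Borel sets and the image map *)

Section BorelSets.
Context {X : topologicalType}.
Implicit Types A B : set X.

Lemma borel_sigma : sigma_algebra [set: X] (@borel_set X).
Proof. exact: smallest_sigma_algebra. Qed.

Lemma borel_open A : open A -> borel_set A.
Proof. by move=> oA; apply: sub_sigma_algebra. Qed.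

Lemma borel_not A : borel_set A -> borel_set [set x | ~ A x].
Proof.
by move=> bA; have [_ h _] := borel_sigma; have := h _ bA; rewrite setTD.
Qed.

Lemma borel_ex (T : countType) (A : T -> set X) :
  (forall z, borel_set (A z)) -> borel_set [set x | exists z, A z x].
Proof.
move=> bA; have [b0 _ bU] := borel_sigma.
rewrite (_ : mkset _ = \bigcup_n (if unpickle n is Some z then A z else set0)).
  by apply: bU => n; case: (unpickle n).
rewrite eqEsubset; split=> [x [z Az]|x [n _]].
  by exists (pickle z) => //; rewrite pickleK.
by case: (unpickle n) => // z Az; exists z.
Qed.

Lemma borel_all (T : countType) (A : T -> set X) :
  (forall z, borel_set (A z)) -> borel_set [set x | forall z, A z x].
Proof.
move=> bA; rewrite (_ : mkset _ = [set x | ~ exists z, ~ A z x]).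
  by apply: borel_not; apply: borel_ex => z; exact: borel_not.
rewrite eqEsubset; split=> x /= h; first by move=> [z].
by move=> z; apply: contrapT => nA; apply: h; exists z.
Qed.

Lemma borel_and A B : borel_set A -> borel_set B -> borel_set [set x | A x /\ B x].
Proof.
move=> bA bB; rewrite (_ : mkset _ = [set x | forall b : bool, (if b then A else B) x]).
  by apply: borel_all => -[].
rewrite eqEsubset; split=> x /= h; first by case: h => ? ? [].
by split; [exact: (h true)|exact: (h false)].
Qed.

Lemma borel_or A B : borel_set A -> borel_set B -> borel_set [set x | A x \/ B x].
Proof.
move=> bA bB; rewrite (_ : mkset _ = [set x | exists b : bool, (if b then A else B) x]).
  by apply: borel_ex => -[].
rewrite eqEsubset; split=> x /= h; first by case: h => ?; [exists true|exists false].
by case: h => -[]; [left|right].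
Qed.

Lemma borel_const (P : Prop) : borel_set [set _ : X | P].
Proof.
have [b0 _ _] := borel_sigma; have [p|p] := pselect P.
  rewrite (_ : mkset _ = setT); first by apply: borel_open; exact: openT.
  by rewrite eqEsubset; split.
by rewrite (_ : mkset _ = set0) // eqEsubset; split.
Qed.

Lemma borel_imp (P : Prop) A : (P -> borel_set A) -> borel_set [set x | P -> A x].
Proof.
move=> bA; have [p|p] := pselect P.
  by rewrite (_ : mkset _ = A) ?eqEsubset; [exact: bA|split=> x //=; auto].
rewrite (_ : mkset _ = setT); first by apply: borel_open; exact: openT.
by rewrite eqEsubset; split=> // x _ /p.
Qed.

End BorelSets.

Lemma borel_preimage (X Y : topologicalType) (f : X -> Y) (A : set Y) :
  borel_measurable f -> borel_set A -> borel_set (f @^-1` A).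
Proof.
move=> mf bA; have : [set B | borel_set (f @^-1` B)] A.
  apply: bA; split; last by move=> U; exact: mf.
  split=> /=; first exact: (borel_const False).
  - by move=> B bB; rewrite setTD; exact: borel_not.
  - move=> B bB; rewrite (_ : _ @^-1` _ = [set x | exists n, B n (f x)]).
      by apply: borel_ex => n; exact: bB.
    by rewrite eqEsubset; split=> x /= [n]; [move=> _ ?; exists n|move=> ?; exists n].
by [].
Qed.

Lemma borel_continuous (X Y : topologicalType) (f : X -> Y) :
  continuous f -> borel_measurable f.
Proof. by move=> /continuousP cf U oU; apply: borel_open; exact: cf. Qed.

Section PathHits.
Variable R : realType.
Local Notation I := (unit_interval R).
Local Notation Q := (hilbert_cube R).
Local Notation X := (path_space R).
Local Notation d := (@mdist R Q).

Lemma path_imageE (g : X) : path_image g = range (eval_path g).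
Proof. by []. Qed.

Lemma open_hit (U : set Q) : open U -> open [set g : X | range (eval_path g) `&` U !=set0].
Proof.
move=> oU; rewrite openE => g [_ [[t _ <-] Ut]].
have /nbhs_dist[e e0 eU] : nbhs (eval_path g t) U by exact: open_nbhs_nbhs.
apply/nbhs_path; exists e => // h gh; exists (eval_path h t); split; first by exists t.
exact: eU.
Qed.

Lemma compact_subset_open (K U : set Q) : compact K -> open U -> K `<=` U ->
  exists2 e : R, 0 < e & forall x y, K x -> d x y < e -> U y.
Proof.
move=> cK oU KU.
have [x Kx|r r0 hr] := @compact_uniform_radius R Q K
    (fun r x => forall y, d x y < r -> U y) cK; last by exists r => // x y /hr; exact.
have /nbhs_dist[e e0 eU] : nbhs x U by apply: open_nbhs_nbhs; split=> //; exact: KU.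
exists (e / 2); first by rewrite divr_gt0.
apply/nbhs_dist; exists (e / 2); first by rewrite divr_gt0.
by move=> y xy r rr z yz; apply: eU; have := metric_triangle x y z; lra.
Qed.

(** By compactness, the image of g has a neighbourhood of fixed radius inside U. *)
Lemma open_inside (U : set Q) : open U -> open [set g : X | range (eval_path g) `<=` U].
Proof.
move=> oU; rewrite openE => g gU.
have [e e0 eU] := compact_subset_open (compact_range (@eval_path_continuous _ g)) oU gU.
apply/nbhs_path; exists e => // h gh _ [t _ <-].
by apply: eU (gh t); exists t.
Qed.

Definition image_hyper (g : X) : hyperspace Q :=
  SigSub (mem_set (conj (ex_intro _ _ (imageT (eval_path g) (clamp 0)))
    (compact_range (@eval_path_continuous _ g)) :
    [set K : set Q | K !=set0 /\ compact K] (range (eval_path g)))).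

Definition image_continuum (g : X) : set_type (@peano_subcontinua R) :=
  SigSub (mem_set (peano_range (@eval_path_continuous _ g) :
    @peano_subcontinua R (image_hyper g))).

Lemma underlying_image g : underlying (image_continuum g) = range (eval_path g).
Proof. by []. Qed.

Lemma image_continuum_continuous : continuous image_continuum.
Proof.
apply: (@continuous_comp_initial _ X (hyperspace Q) set_val image_continuum).
apply/continuousP => U.
move=> [B sB <-]; rewrite openE => g [C BC Cg].
suff : nbhs g ((set_val \o image_continuum) @^-1` C) by apply: filterS => h Ch; exists C.
have [F FD CE] := sB _ BC; move: Cg; rewrite -CE => Cg.
rewrite preimage_bigcap; apply: filter_bigI => -[b V] /= VF.
have /set_mem /= oV := FD _ VF; have := Cg _ VF.
case: b {VF} => /= Vg.
  by apply: open_nbhs_nbhs; split; [exact: (open_inside oV)|exact: Vg].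
by apply: open_nbhs_nbhs; split; [exact: (open_hit oV)|exact: Vg].
Qed.

End PathHits.

(** * Borel selection of a path *)

Section Selection.
Variable R : realType.
Local Notation I := (unit_interval R).
Local Notation Q := (hilbert_cube R).
Local Notation X := (path_space R).
Local Notation d := (@mdist R Q).
Local Notation ep := (@ep R).
Variable D : nat -> Q.
Local Notation x0 := (D 0%N).
(* [step n z z' x] says that z' is an admissible successor of z at stage n for
   the datum x; sequences are given by indices into the dense sequence D. *)
Variables (T : Type) (step : nat -> seq nat -> seq nat -> T -> Prop) (z0 : seq nat).
Hypothesis z0_gt0 : (0 < size z0)%N.
Hypothesis z0_mesh : mesh x0 (2 * ep 0) (map D z0).
Hypothesis step_refines : forall n z z' x, step n z z' x ->
  refines x0 (ep n) (map D z) (map D z').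
Hypothesis step_mesh : forall n z z' x, step n z z' x ->
  mesh x0 (2 * ep n.+1) (map D z').

Definition constant_path : X := mkpath (@cst_continuous I Q x0).

(** Least in the enumeration of finite sequences, not chosen abstractly: this is
what makes the selection Borel in x. *)
Definition first_step n z z' x :=
  step n z z' x /\ forall z'', step n z z'' x -> (pickle z' <= pickle z'')%N.

(** The sequence of successive choices, as a relation because it stops at a stage
without an admissible successor. *)
Fixpoint reach n z x : Prop :=
  if n is m.+1 then exists z', reach m z' x /\ first_step m z' z x else z = z0.

Definition good x := forall n, exists z, reach n z x.

Lemma first_step_uniq n z z1 z2 x :
  first_step n z z1 x -> first_step n z z2 x -> z1 = z2.
Proof.
move=> [s1 l1] [s2 l2]; apply: (pcan_inj (@pickleK _)); apply/eqP.
by rewrite eqn_leq l1 // l2.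
Qed.

Lemma reach_uniq n z1 z2 x : reach n z1 x -> reach n z2 x -> z1 = z2.
Proof.
elim: n z1 z2 => [|n ih] z1 z2 /=; first by move=> -> ->.
move=> [y1 [r1 f1]] [y2 [r2 f2]]; rewrite (ih _ _ r1 r2) in f1.
exact: first_step_uniq f1 f2.
Qed.

Lemma first_step_ex n z x : (exists z', step n z z' x) -> exists z', first_step n z z' x.
Proof.
move=> [z1 s1].
have ex : exists m, `[< exists z', pickle z' = m /\ step n z z' x >].
  by exists (pickle z1); apply/asboolP; exists z1.
case: (ex_minnP ex) => m /asboolP[z' [zm s']] mmin; exists z'; split=> //.
by move=> z'' s''; rewrite zm; apply: mmin; apply/asboolP; exists z''.
Qed.

(** The selection never stops if some invariant guarantees an admissible successor
and is preserved by every admissible step. *)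
Lemma good_inv (inv : nat -> seq nat -> Prop) x : inv 0%N z0 ->
  (forall n z, inv n z -> exists z', step n z z' x) ->
  (forall n z z', inv n z -> step n z z' x -> inv n.+1 z') -> good x.
Proof.
move=> i0 ex istep n.
suff [z [_ rz]] : exists z, inv n z /\ reach n z x by exists z.
elim: n => [|n [z [iz rz]]]; first by exists z0.
have [z' [s' m']] := first_step_ex (ex n z iz).
by exists z'; split; [exact: istep iz s'|exists z].
Qed.

Lemma good_path x : good x -> exists g : X,
  forall n z t, reach n z x -> d (eval_path g t) (step_path x0 (map D z) t) <= 2 * ep n.
Proof.
move=> /choice[z hz].
have fz n : first_step n (z n) (z n.+1) x.
  by have /= [z' [rz' fz']] := hz n.+1; rewrite (reach_uniq (hz n) rz').
have szr n : refines x0 (ep n) (map D (z n)) (map D (z n.+1)).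
  by have [s _] := fz n; exact: step_refines s.
have sz n : (0 < size (map D (z n)))%N.
  elim: n => [|n ih]; first by rewrite size_map (hz 0%N : z 0%N = z0).
  by have [k k0 [-> _]] := szr n; rewrite muln_gt0 ih.
have mz n : mesh x0 (2 * ep n) (map D (z n)).
  case: n => [|n]; first by rewrite (hz 0%N : z 0%N = z0).
  by have [s _] := fz n; exact: step_mesh s.
have [f fc hf] := limit_path (@compact_Q R) sz szr mz.
by exists (mkpath fc) => n z' t rz'; rewrite (reach_uniq rz' (hz n)); exact: hf.
Qed.

Definition follows (F : T -> X) := forall x,
  (good x -> forall n z t, reach n z x ->
    d (eval_path (F x) t) (step_path x0 (map D z) t) <= 2 * ep n) /\
  (~ good x -> F x = constant_path).

Lemma selected_path : exists F, follows F.
Proof.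
suff /choice[F hF] : forall x, exists g : X, (good x -> forall n z t, reach n z x ->
    d (eval_path g t) (step_path x0 (map D z) t) <= 2 * ep n) /\ (~ good x -> g = constant_path) by exists F.
move=> x; have [gx|ngx] := pselect (good x); last by exists constant_path.
by have [g hg] := good_path gx; exists g.
Qed.

Variables (W : topologicalType) (param : W -> T).
Hypothesis step_borel : forall n z z', borel_set [set y | step n z z' (param y)].

Lemma first_step_borel n z z' : borel_set [set y | first_step n z z' (param y)].
Proof.
apply: (borel_and (step_borel n z z')).
apply: (@borel_all _ _ (fun z'' y =>
  step n z z'' (param y) -> (pickle z' <= pickle z'')%N)) => z''.
rewrite (_ : (fun=> _) = [set y | ~ step n z z'' (param y) \/ (pickle z' <= pickle z'')%N]).
  by apply: borel_or; [exact: borel_not (step_borel n z z'')|exact: borel_const].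
rewrite eqEsubset; split=> y /= h; last by case: h.
by have [s|s] := pselect (step n z z'' (param y)); [right; exact: h|left].
Qed.

Lemma reach_borel n z : borel_set [set y | reach n z (param y)].
Proof.
elim: n z => [|n ih] z /=; first exact: borel_const.
by apply: borel_ex => z'; exact: (borel_and (ih z') (first_step_borel n z' z)).
Qed.

(** When the selection never stops, F x lies in an open set U exactly when, at some
stage, every path compatible with the selected step function lies in U. There are countably many stages and
step functions, and being selected at a stage is a Borel condition. *)
Lemma selected_borel (F : T -> X) : follows F -> borel_measurable (F \o param).
Proof.
move=> hF U oU.
have bgood : borel_set [set y | good (param y)].
  by apply: borel_all => n; apply: borel_ex => z; exact: reach_borel.
(* the step function of z at stage n forces a path into U *)
pose inU n z := forall g : X,
  (forall t, d (eval_path g t) (step_path x0 (map D z) t) <= 2 * ep n) -> U g.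
rewrite (_ : _ @^-1` U = [set y | (good (param y) /\
    exists n, exists z, inU n z /\ reach n z (param y)) \/
    (~ good (param y) /\ U constant_path)]).
  apply: borel_or; [apply: (borel_and bgood)|apply: (borel_and (borel_not bgood))].
  - apply: borel_ex => n; apply: borel_ex => z; apply: borel_and.
      exact: borel_const.
    exact: reach_borel.
  - exact: borel_const.
rewrite eqEsubset; split=> y /=; last first.
  case=> [[gy [n [z [Uz rz]]]]|[ngy Up]]; last by have [_ ->] := hF (param y).
  by apply: Uz => t; have [h _] := hF (param y); exact: h.
move=> Uy; have [h1 h2] := hF (param y).
have [gy|ngy] := pselect (good (param y)); last by right; rewrite -h2.
left; split=> //.
have /nbhs_path[e e0 eU] : nbhs (F (param y)) U by exact: open_nbhs_nbhs.
have [n ne] := ep_small (divr_gt0 e0 (ltr0n R 4)).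
have [z rz] := gy n; exists n, z; split=> // g hg; apply: eU => t.
have := h1 gy n z t rz; have := hg t.
have := metric_triangle (eval_path (F (param y)) t) (step_path x0 (map D z) t) (eval_path g t).
by rewrite (metric_sym (eval_path g t)); lra.
Qed.

End Selection.

(** * A Borel section of the image map *)

Section PeanoSection.
Variable R : realType.
Local Notation I := (unit_interval R).
Local Notation Q := (hilbert_cube R).
Local Notation X := (path_space R).
Local Notation d := (@mdist R Q).
Local Notation ep := (@ep R).
Variable D : nat -> Q.
Local Notation x0 := (D 0%N).
Hypothesis Ddense : forall x e, 0 < e -> exists n, d x (D n) < e.

Lemma dist_lt1 (x y : Q) : d x y < 1.
Proof. by apply: le_lt_trans (qdist_half x y) _; lra. Qed.

Lemma approximates_le e e' (w : seq Q) K : e <= e' ->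
  approximates x0 e w K -> approximates x0 e' w K.
Proof.
move=> ee [w0 mw wK Kw]; split=> //.
- by move=> i iw; apply: lt_le_trans (mw i iw) ee.
- by move=> j jw; have [y Ky yj] := wK j jw; exists y => //; exact: lt_le_trans ee.
- by move=> y /Kw[j jw yj]; exists j => //; exact: lt_le_trans ee.
Qed.

Lemma approximates_borel e (w : seq Q) :
  borel_set [set g : X | approximates x0 e w (range (eval_path g))].
Proof.
pose B1 (g : X) := forall j, (j < size w)%N ->
  range (eval_path g) `&` [set y | d (nth x0 w j) y < e] !=set0.
pose B2 (g : X) := range (eval_path g) `<=`
  \bigcup_(j in [set j | (j < size w)%N]) [set y | d (nth x0 w j) y < e].
rewrite (_ : mkset _ = [set g | ((0 < size w)%N /\ mesh x0 e w) /\ (B1 g /\ B2 g)]).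
  apply: borel_and; first exact: borel_const.
  apply: borel_and.
    apply: borel_all => j; apply: borel_imp => jw; apply: borel_open.
    by apply: open_hit; exact: open_dist.
  apply: borel_open; apply: open_inside; apply: bigcup_open => j _.
  exact: open_dist.
rewrite eqEsubset; split=> g /=.
  move=> [w0 mw wK Kw]; split; split=> //.
    by move=> j /wK[y Ky yj]; exists y.
  by move=> y /Kw[j jw yj]; exists j; rewrite //= metric_sym.
move=> [[w0 mw] [b1 b2]]; split=> //.
  by move=> j /b1[y [Ky yj]]; exists y.
by move=> y /b2[j jw yj]; exists j; rewrite //= metric_sym.
Qed.

(** The invariant of the construction: z has refinements that approximate K to any
precision. *)
Definition resolvable n z K := forall N, exists z', 
  refines x0 (ep n) (map D z) (map D z') /\ approximates x0 (ep N) (map D z') K.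

Definition peano_step n z z' K :=
  (refines x0 (ep n) (map D z) (map D z') /\ approximates x0 (ep n) (map D z') K) /\
  resolvable n.+1 z' K.

Lemma peano_step_borel n z z' :
  borel_set [set g : X | peano_step n z z' (range (eval_path g))].
Proof.
apply: borel_and.
  exact: (borel_and (borel_const _) (approximates_borel _ _)).
apply: borel_all => N; apply: borel_ex => z''.
exact: (borel_and (borel_const _) (approximates_borel _ _)).
Qed.

(** Among the approximations provided by the invariant, one that is fine enough
for [extension] satisfies the invariant again. *)
Lemma peano_good K : compact K -> connected K -> K !=set0 ->
  locally_connected (set_type K) -> good peano_step [:: 0%N] K.
Proof.
move=> cK conK K0 lK; apply: (@good_inv _ _ _ (fun n z => resolvable n z K)).
- move=> N; have [z rz az] := extension_start x0 Ddense (D 0) cK conK K0 dist_lt1 (ep_gt0 R N).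
  by exists z.
- move=> n z hz; have [dl dl0 hdl] := extension x0 Ddense cK lK (ep_gt0 R n.+1).
  have [N Ndl] := ep_small dl0.
  have [z' [rz az]] := hz (maxn n N); exists z'; split.
    by split=> //; apply: approximates_le az; rewrite ep_le // leq_maxl.
  have Ndl' : ep (maxn n N) < dl by apply: le_lt_trans Ndl; rewrite ep_le // leq_maxr.
  by move=> N'; have [z'' rz' az'] := hdl _ _ Ndl' az _ (ep_gt0 R N'); exists z''.
- by move=> n z z' _ [].
Qed.

(** The limit path stays close to K and comes close to every point of K at every
scale; both K and the image of the path are closed. *)
Lemma peano_section : exists G : set Q -> X,
  borel_measurable (G \o (fun g : X => range (eval_path g))) /\
  forall K, compact K -> connected K -> K !=set0 ->
    locally_connected (set_type K) -> range (eval_path (G K)) = K.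
Proof.
have sM n z z' (K : set Q) : peano_step n z z' K ->
    mesh x0 (2 * ep n.+1) (map D z').
  by move=> [[_ [_ mz _ _]] _]; rewrite epS mulrC divfK.
have sR n z z' (K : set Q) : peano_step n z z' K ->
    refines x0 (ep n) (map D z) (map D z') by case=> [[]].
have m0 : mesh x0 (2 * ep 0) (map D [:: 0%N]) by case.
have [G hG] := @selected_path R D (set Q) peano_step [:: 0%N] isT m0 sR sM.
exists G; split.
  exact: (selected_borel peano_step_borel hG).
move=> K cK conK K0 lK.
have gK := peano_good cK conK K0 lK.
have {hG} [/(_ gK) hG _] := hG K.
have fine n : exists2 w, approximates x0 (ep n) w K &
    forall t, d (eval_path (G K) t) (step_path x0 w t) <= ep n.
  have [z rz] := gK n.+1; have /= [z' [_ [[[_ az] _] _]]] := rz.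
  exists (map D z) => // t; have := hG _ _ t rz; by rewrite epS mulrC divfK.
rewrite eqEsubset; split=> [_ [t _ <-]|y Ky].
  apply: compact_approx cK _ => e e0.
  have [n ne] := ep_small (divr_gt0 e0 (ltr0n R 2)).
  have [w [w0 _ wK _] hw] := fine n.
  have [y Ky yw] := wK _ (idx_lt t w0); exists y => //.
  have := hw t; have := metric_triangle (eval_path (G K) t) (step_path x0 w t) y.
  rewrite /step_path; lra.
apply: compact_approx (compact_range (@eval_path_continuous _ (G K))) _ => e e0.
have [n ne] := ep_small (divr_gt0 e0 (ltr0n R 2)).
have [w [w0 _ _ Kw] hw] := fine n.
have [j jw yj] := Kw _ Ky.
exists (eval_path (G K) (node R (size w) j)); first by exists (node R (size w) j).
have := hw (node R (size w) j); rewrite /step_path idx_node //.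
have := metric_triangle y (nth x0 w j) (eval_path (G K) (node R (size w) j)).
by rewrite (metric_sym (nth x0 w j)); lra.
Qed.

End PeanoSection.

(** * Encoding a path in a single point *)

Section Decoder.
Variable R : realType.
Local Notation I := (unit_interval R).
Local Notation Q := (hilbert_cube R).
Local Notation X := (path_space R).
Local Notation d := (@mdist R Q).
Local Notation ep := (@ep R).
Local Notation node := (@node R).

Lemma path_uniform_continuity (g : X) (e : R) : 0 < e -> exists2 dl : R, 0 < dl &
  forall s t, `|ival s - ival t| < dl -> d (eval_path g s) (eval_path g t) < e.
Proof.
move=> e0.
have [s _|r r0 hr] := @compact_uniform_radius R I setT (fun r s => forall t : I,
    `|ival s - ival t| < r -> d (eval_path g s) (eval_path g t) < e) (@compact_I R); last first.
  by exists r => // s t; exact: hr.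
have /(@eval_path_continuous _ g)/nbhs_I[r r0 hr] : nbhs (eval_path g s) [set y | d (eval_path g s) y < e / 2].
  by apply/nbhs_dist; exists (e / 2); rewrite ?divr_gt0.
exists (r / 2); first by rewrite divr_gt0.
apply/nbhs_I; exists (r / 2); first by rewrite divr_gt0.
move=> t st r' rr' u tu.
have /= h1 : d (eval_path g s) (eval_path g t) < e / 2 by apply: hr; lra.
have /= h2 : d (eval_path g s) (eval_path g u) < e / 2.
  by apply: hr; have := ler_distD (ival t) (ival s) (ival u); lra.
have := metric_triangle (eval_path g t) (eval_path g s) (eval_path g u).
by rewrite (metric_sym (eval_path g t) (eval_path g s)); lra.
Qed.

Lemma invr_small (e : R) : 0 < e -> exists2 m, (0 < m)%N & m%:R^-1 < e.
Proof.
move=> e0; have [n ne] := ep_small e0; exists (2 ^ n)%N; first by rewrite expn_gt0.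
by rewrite natrX -exprVn.
Qed.

Lemma node_dense (g h : X) :
  (forall m i, eval_path g (node m i) = eval_path h (node m i)) -> g = h.
Proof.
move=> gh; apply: path_ext => t; apply: mdist_small_eq => e e0.
have e2 : 0 < e / 2 by rewrite divr_gt0.
have [dg dg0 hg] := path_uniform_continuity g e2; have [dh dh0 hh] := path_uniform_continuity h e2.
have m0 : 0 < Num.min dg dh by rewrite lt_min dg0.
have [m m_gt0] := invr_small m0; rewrite lt_min => /andP[mg mh].
have tn := node_near t m_gt0; set s := node m _ in tn.
have := hg _ _ (le_lt_trans tn mg); have := hh _ _ (le_lt_trans tn mh).
have := metric_triangle (eval_path g t) (eval_path g s) (eval_path h t).
rewrite /s gh -/s (metric_sym (eval_path h t) (eval_path h s)); lra.
Qed.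

Variable D : nat -> Q.
Local Notation x0 := (D 0%N).
Hypothesis Ddense : forall x e, 0 < e -> exists n, d x (D n) < e.

(** For a prescribed m, so that the step function can be taken to subdivide a
given one. *)
Lemma path_approx (g : X) (e : R) m : 0 < e -> (0 < m)%N ->
  exists k, exists z : seq nat, [/\ (0 < k)%N, size z = (m * k)%N,
    forall t, d (eval_path g t) (step_path x0 (map D z) t) < e & mesh x0 (2 * e) (map D z)].
Proof.
move=> e0 m0; have e2 : 0 < e / 2 by rewrite divr_gt0.
have [dl dl0 hg] := path_uniform_continuity g e2; have [k k0 kd] := invr_small dl0.
have mk0 : (0 < m * k)%N by rewrite muln_gt0 m0.
have mk0' : 0 < (m * k)%:R :> R by rewrite ltr0n.
have mkd : (m * k)%:R^-1 < dl.
  apply: le_lt_trans kd; rewrite lef_pV2 ?posrE ?ltr0n // ler_nat; nia.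
have /choice[c hc] : forall j, exists a, d (eval_path g (node (m * k) j)) (D a) < e / 2.
  by move=> j; exact: Ddense.
have nz j : (j < m * k)%N -> nth x0 (map D (mkseq c (m * k))) j = D (c j).
  by move=> jm; rewrite (nth_map 0%N) ?size_mkseq // nth_mkseq.
exists k, (mkseq c (m * k)); rewrite size_mkseq; split=> //.
- move=> t; rewrite /step_path size_map size_mkseq.
  have it := idx_lt t mk0; rewrite nz //.
  have := hc (idx (m * k) t); have := hg _ _ (le_lt_trans (node_near t mk0) mkd).
  have := metric_triangle (eval_path g t) (eval_path g (node (m * k) (idx (m * k) t)))
    (D (c (idx (m * k) t))).
  lra.
- move=> i; rewrite size_map size_mkseq => im; have im' := ltnW im.
  rewrite !nz //.
  have := hc i; have := hc i.+1.
  have := hg (node (m * k) i) (node (m * k) i.+1).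
  rewrite !ival_node ?(ltnW im') // -mulrBl -[i.+1%:R]natr1 opprD addrA subrr sub0r.
  rewrite mulN1r normrN gtr0_norm ?invr_gt0 // => /(_ mkd).
  have := metric_triangle (D (c i)) (eval_path g (node (m * k) i)) (D (c i.+1)).
  have := metric_triangle (eval_path g (node (m * k) i)) (eval_path g (node (m * k) i.+1))
    (D (c i.+1)).
  rewrite (metric_sym (D (c i)) (eval_path g (node (m * k) i))); lra.
Qed.

(** The homeomorphism of Q x Q with Q that interleaves coordinates. *)
Definition pairQ (x u : Q) : Q := fun k => if odd k then u k./2 else x k./2.

(** Coordinate k is coordinate l of g at the rational i/m, where k enumerates the
triples (m, i, l). *)
Definition path_values (g : X) : Q := fun k =>
  let mil := odflt (0%N, 0%N, 0%N) (unpickle k) in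
  eval_path g (node mil.1.1 mil.1.2) mil.2.

Definition coords (s : nat -> nat) (v : Q) : Q := fun k => v (s k).

(** The value at i/m of the path encoded in the odd coordinates of v. *)
Definition node_value (v : Q) (m i : nat) : Q :=
  coords (fun l => (pickle (m, i, l)).*2.+1) v.

Lemma pairQ_odd x u a : pairQ x u a.*2.+1 = u a.
Proof.
by rewrite /pairQ oddS odd_double /= uphalf_double.
Qed.

Lemma pairQ_even x u a : pairQ x u a.*2 = x a.
Proof. by rewrite /pairQ odd_double doubleK. Qed.

Lemma pairQ_lip x y u : d (pairQ x u) (pairQ y u) <= d x y.
Proof.
apply: qdist_le => k; rewrite /qterm /pairQ; case: ifP => _.
  by rewrite subrr normr0 mul0r mdist_ge0.
apply: le_trans (qterm_le x y k./2); apply: ler_wpM2l => //.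
by apply: ep_le; rewrite ltnS -divn2 leq_div.
Qed.

Lemma pairQ_continuous u : continuous (pairQ ^~ u).
Proof.
move=> x A /nbhs_dist[e e0 eA]; apply/nbhs_dist; exists e => // y xy.
by apply: eA; apply: le_lt_trans xy; exact: pairQ_lip.
Qed.

Lemma encoded_path_continuous (g : X) : continuous (fun t => pairQ (eval_path g t) (path_values g)).
Proof.
move=> t; apply: (@continuous_comp _ _ _ (eval_path g) (pairQ ^~ (path_values g))).
  exact: eval_path_continuous.
exact: pairQ_continuous.
Qed.

Definition encode (g : X) : X := mkpath (@encoded_path_continuous g).

Lemma node_value_encode g t m i : node_value (eval_path (encode g) t) m i = eval_path g (node m i).
Proof.
apply: functional_extensionality_dep => l.
by rewrite /node_value /coords [LHS]pairQ_odd /path_values pickleK.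
Qed.

Lemma small_radii N (c : nat -> R) : (forall k, 0 < c k) ->
  exists2 r, 0 < r & forall k, (k < N)%N -> r <= c k.
Proof.
move=> c0; have [p r r' rr' rc|p _|r r0 hr] := @common_radius R nat (iota 0 N) (fun k r => r <= c k).
- exact: le_trans rc.
- by exists (c p).
- by exists r => // k kN; apply: hr; rewrite mem_iota.
Qed.

Lemma coords_continuous s : continuous (coords s).
Proof.
move=> x A /nbhs_dist[e e0 eA]; have [N Ne] := ep_small e0.
have [r r0 hr] := small_radii N (fun k => mulr_gt0 e0 (ep_gt0 R (s k).+1)).
apply/nbhs_dist; exists r => // y xy; apply: eA; apply: (qdist_lt_of e0 Ne) => k kN.
rewrite -(ltr_pM2r (ep_gt0 R (s k).+1)).
exact: le_lt_trans (qterm_le x y (s k)) (lt_le_trans xy (hr k kN)).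
Qed.

(** Up to e only finitely many coordinates of the code matter, and each of them is
a coordinate of g at some time, controlled uniformly by the distance of paths. *)
Lemma encode_continuous : continuous encode.
Proof.
move=> g A /nbhs_path[e e0 eA]; have [N Ne] := ep_small e0.
(* coordinate k of an encoded path is coordinate [lab k] of the path itself *)
pose lab k := if odd k then (odflt (0%N, 0%N, 0%N) (unpickle k./2)).2 else k./2.
have [r r0 hr] := small_radii N (fun k => mulr_gt0 e0 (ep_gt0 R (lab k).+1)).
apply/nbhs_path; exists r => // h gh; apply: eA => t.
apply: (qdist_lt_of e0 Ne) => k kN; rewrite -(ltr_pM2r (ep_gt0 R (lab k).+1)).
have rk := hr k kN.
have key s : `|ival (eval_path g s (lab k)) - ival (eval_path h s (lab k))| *
    ep (lab k).+1 < e * ep (lab k).+1.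
  exact: le_lt_trans (qterm_le _ _ _) (lt_le_trans (gh s) rk).
by move: key; rewrite /encode !eval_mkpath /lab /pairQ /path_values; case: ifP => _ key; exact: key.
Qed.

End Decoder.

(** * A Borel decoder *)

Section DecoderSelection.
Variable R : realType.
Local Notation I := (unit_interval R).
Local Notation Q := (hilbert_cube R).
Local Notation X := (path_space R).
Local Notation d := (@mdist R Q).
Local Notation ep := (@ep R).
Local Notation node := (@node R).
Variable D : nat -> Q.
Local Notation x0 := (D 0%N).
Hypothesis Ddense : forall x e, 0 < e -> exists n, d x (D n) < e.

Definition close_at_nodes n z (v : Q) := forall mi : nat * nat,
  d (node_value v mi.1 mi.2) (step_path x0 (map D z) (node mi.1 mi.2)) <= ep n / 2.

(** The step function of z' approximates the path encoded in v at all rational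
times. The factor 1/2 in the approximation makes any two good approximations at
stages n and n+1 closer than ep n, since 1/2 + 1/4 < 1. *)
Definition decode_step n z z' v :=
  (refines x0 (ep n) (map D z) (map D z') /\ mesh x0 (2 * ep n.+1) (map D z')) /\
  close_at_nodes n.+1 z' v.

Lemma decode_step_borel n z z' :
  borel_set [set g : X | decode_step n z z' (eval_path g (clamp 0))].
Proof.
apply: borel_and; first exact: borel_const.
apply: borel_all => -[m i] /=.
rewrite (_ : (fun=> _) = [set g : X | ~ (ep n.+1 / 2 <
  d (node_value (eval_path g (clamp 0)) m i) (step_path x0 (map D z') (node m i)))]).
  apply: borel_not; apply: borel_open.
  have c : continuous (fun g : X => node_value (eval_path g (clamp 0)) m i).
    move=> g; apply: (@continuous_comp _ _ _ (fun g : X => eval_path g (clamp 0))).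
      exact: evaluation_continuous.
    exact: coords_continuous.
  exact: (continuousP _).1 c _ (open_dist_gt _ _).
by apply/funext => g /=; apply/propext; rewrite leNgt; split=> /negP.
Qed.

(** By [path_approx] the encoded path has good approximations that subdivide any
given one. At stage 0 every sequence approximates, as distances are at most 1/2. *)
Lemma decode_good (g : X) t : good decode_step [:: 0%N] (eval_path (encode g) t).
Proof.
apply: (@good_inv _ _ _ (fun n z => (0 < size z)%N /\ close_at_nodes n z (eval_path (encode g) t))).
- by split=> // mi; exact: qdist_half.
- move=> n z [z_gt0 hz].
  have e0 : 0 < ep n.+1 / 2 by rewrite divr_gt0 ?ep_gt0.
  have [k [z' [k0 sz' app mz']]] := path_approx Ddense g e0 z_gt0.
  exists z'; split; last first.
    by move=> mi; rewrite node_value_encode ltW.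
  split; last first.
    by move=> i im; apply: lt_le_trans (mz' i im) _; have := ep_gt0 R n.+1; lra.
  exists k => //; rewrite !size_map; split=> // j jz'.
  have := app (node (size z') j).
  rewrite /step_path size_map idx_node // => h1.
  have := hz (size z', j); rewrite node_value_encode /= /step_path size_map.
  rewrite -(idx_div _ z_gt0 k0) -sz' idx_node // => h2.
  have := metric_triangle (nth x0 (map D z') j) (eval_path g (node (size z') j))
    (nth x0 (map D z) (j %/ k)).
  rewrite (metric_sym (nth x0 (map D z') j) (eval_path g (node (size z') j))).
  by move: h1 h2; rewrite epS; have := ep_gt0 R n; lra.
- move=> n z z' [z_gt0 _] [[[k k0 [sz' _]] _] hz]; split=> //.
  by move: sz'; rewrite !size_map => ->; rewrite muln_gt0 z_gt0.
Qed.

(** The decoded path is close at rational times to the step functions that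
approximate g there, so it agrees with g at all rational times. *)
Lemma decoder : exists dec : Q -> X,
  borel_measurable (fun g : X => dec (eval_path g (clamp 0))) /\
  forall g t, dec (eval_path (encode g) t) = g.
Proof.
have sM n z z' v : decode_step n z z' v -> mesh x0 (2 * ep n.+1) (map D z') by case=> [[]].
have sR n z z' v : decode_step n z z' v ->
    refines x0 (ep n) (map D z) (map D z') by case=> [[]].
have m0 : mesh x0 (2 * ep 0) (map D [:: 0%N]) by case.
have [F hF] := @selected_path R D Q decode_step [:: 0%N] isT m0 sR sM.
exists F; split; first exact: (selected_borel decode_step_borel hF).
move=> g t; have gv := decode_good g t; have {hF} [/(_ gv) hF _] := hF (eval_path (encode g) t).
apply: node_dense => m i; apply: mdist_small_eq => e e0.
have [n ne] := ep_small (divr_gt0 e0 (ltr0n R 3)).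
have [z rz] := gv n.+1; have h1 := hF _ _ (node m i) rz.
have /= [z' [_ [[_ hz] _]]] := rz.
have h2 := hz (m, i); rewrite node_value_encode /= in h2.
have := metric_triangle (eval_path (F (eval_path (encode g) t)) (node m i))
  (step_path x0 (map D z) (node m i)) (eval_path g (node m i)).
move: h1 h2; rewrite epS (metric_sym (eval_path g (node m i))); have := ep_gt0 R n; lra.
Qed.

End DecoderSelection.

(** * The Cantor-Schroeder-Bernstein bijection *)

Section FixedPoints.
Variable R : realType.
Local Notation I := (unit_interval R).
Local Notation Q := (hilbert_cube R).
Local Notation X := (path_space R).
Local Notation d := (@mdist R Q).
Local Notation ep := (@ep R).

(** Two paths are equal iff at all rational times they have common neighbours in
the dense sequence at every scale. *)
Lemma borel_fixed (D : nat -> Q) (F : X -> X) :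
  (forall x e, 0 < e -> exists n, d x (D n) < e) ->
  borel_measurable F -> borel_set [set g | F g = g].
Proof.
move=> Ddense mF.
pose V (m i a n : nat) := [set g : X | d (D a) (eval_path g (node R m i)) < ep n].
have oV m i a n : open (V m i a n).
  exact: (continuousP _).1 (@evaluation_continuous R (node R m i)) _ (open_dist _ _).
rewrite (_ : mkset _ = [set g | forall m, forall i, forall n, exists a,
    V m i a n g /\ V m i a n (F g)]).
  apply: borel_all => m; apply: borel_all => i; apply: borel_all => n.
  apply: borel_ex => a; apply: borel_and; first exact: borel_open.
  exact: mF.
rewrite eqEsubset; split=> g /=.
  move=> -> m i n; have [a ha] := Ddense (eval_path g (node R m i)) _ (ep_gt0 R n).
  by exists a; split; rewrite /V /= metric_sym.
move=> h; apply: node_dense => m i; apply: mdist_small_eq => e e0.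
have [n ne] := ep_small (divr_gt0 e0 (ltr0n R 2)); have [a [/= h1 h2]] := h m i n.
have := metric_triangle (eval_path (F g) (node R m i)) (D a) (eval_path g (node R m i)).
move: h1 h2; rewrite /V /= (metric_sym (eval_path (F g) (node R m i)) (D a)); lra.
Qed.

Lemma homeomorphic_set_type (A B : set Q) (f g : Q -> Q) :
  continuous f -> continuous g -> (forall x, A x -> B (f x)) ->
  (forall y, B y -> A (g y)) -> (forall x, A x -> g (f x) = x) ->
  (forall y, B y -> f (g y) = y) -> homeomorphic (set_type A) (set_type B).
Proof.
move=> cf cg fAB gBA gfK fgK.
exists (fun x : A => SigSub (mem_set (fAB _ (set_valP x))) : B),
       (fun y : B => SigSub (mem_set (gBA _ (set_valP y))) : A); split.
- apply: (@continuous_comp_initial B A Q set_val).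
  by move=> x; apply: (@continuous_comp _ _ _ set_val f); [exact: initial_continuous|exact: cf].
- apply: (@continuous_comp_initial A B Q set_val).
  by move=> x; apply: (@continuous_comp _ _ _ set_val g); [exact: initial_continuous|exact: cg].
- by move=> x; apply: val_inj; apply: gfK; exact: set_valP.
- by move=> x; apply: val_inj; apply: fgK; exact: set_valP.
Qed.

(** The homeomorphism forgets, respectively adds, the constant second factor. *)
Lemma encode_homeomorphic (g : X) :
  homeomorphic (set_type (range (eval_path (encode g)))) (set_type (range (eval_path g))).
Proof.
apply: (@homeomorphic_set_type _ _ (coords double) (fun x : Q => pairQ x (path_values g))).
- exact: coords_continuous.
- exact: pairQ_continuous.
- move=> _ [t _ <-]; exists t => //; apply: functional_extensionality_dep => k.
  by rewrite /coords [RHS]pairQ_even.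
- by move=> _ [t _ <-]; exists t.
- move=> _ [t _ <-]; congr (pairQ _ (path_values g)).
  by apply: functional_extensionality_dep => k; exact: pairQ_even.
- by move=> _ [t _ <-]; apply: functional_extensionality_dep => k; exact: pairQ_even.
Qed.

Lemma homeomorphic_refl (Y : topologicalType) : homeomorphic Y Y.
Proof. by exists id, id; split=> // x. Qed.

End FixedPoints.

Lemma connected_set_val (R : realType) (K : set (hilbert_cube R)) :
  connected [set: set_type K] -> connected K.
Proof.
move=> conK; rewrite (_ : K = set_val @` [set: set_type K]).
  apply: connected_continuous_connected conK _.
  exact/continuous_subspaceT/initial_continuous.
rewrite eqEsubset; split=> [x Kx|_ [x _ <-]]; last exact: set_valP.
by exists (SigSub (mem_set Kx)).
Qed.

(** Borelness is stated after composition with the image map, since only self-maps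
of the path space enter the construction of the bijection. *)
Lemma image_section (R : realType) :
  exists G : set_type (@peano_subcontinua R) -> path_space R,
    borel_measurable (G \o @image_continuum R) /\ cancel G (@image_continuum R).
Proof.
have [D Ddense] := dense_seq (@compact_Q R) (fun=> clamp 0).
have [G [mG hG]] := peano_section Ddense.
exists (fun K => G (underlying K)); split; first exact: mG.
move=> K; do 2 apply: val_inj; rewrite /=.
have [[K0 cK conK _] lK] := set_valP K; have [_ cK'] := set_valP (set_val K).
apply: hG => //; first exact: connected_set_val.
by have [[x Kx] _] := set_valP (set_val K); exists x.
Qed.

Theorem corollary4p16 (R : realType) :
  exists phi : path_space R -> set_type (@peano_subcontinua R),
    [/\ borel_measurable phi, bijective phi &
        forall f : path_space R,
          homeomorphic (set_type (underlying (phi f)))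
                       (set_type (path_image f))].
Proof.
have [D Ddense] := dense_seq (@compact_Q R) (fun=> clamp 0).
have [G [mG GK]] := image_section R.
have [dec [mdec decK]] := decoder Ddense.
pose Dc (g : path_space R) := dec (eval_path g (clamp 0)).
pose h := G \o @image_continuum R \o @encode R.
have mh : borel_measurable h.
  move=> U oU.
  exact: (borel_preimage (borel_continuous (@encode_continuous R)) (mG U oU)).
(* h g has the same image as the code of g, so that its starting point, like
   any point of that image, decodes to g *)
have hK g : Dc (h g) = g.
  have : range (eval_path (h g)) (eval_path (h g) (clamp 0)) by exists (clamp 0).
  have -> : range (eval_path (h g)) = range (eval_path (encode g)).
    by rewrite -!underlying_image /h /= GK.
  by move=> [t _]; rewrite /Dc => <-.
(* A n = h^n (paths outside the range of G), described by going backwards: since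
   Dc inverts h, a path is in the image of h iff it is fixed by h o Dc *)
pose A := fix A n g :=
  if n is m.+1 then h (Dc g) = g /\ A m (Dc g) else G (image_continuum g) <> g.
have mA n : borel_set [set g | A n g].
  elim: n => [|n ih] /=; first exact: (borel_not (borel_fixed Ddense mG)).
  apply: (borel_and (A := [set g | h (Dc g) = g])); last exact: (borel_preimage mdec ih).
  apply: (borel_fixed Ddense (F := h \o Dc)) => U oU.
  exact: (borel_preimage mdec (mh U oU)).
pose inA g := exists n, A n g.
have mInA : borel_set inA by exact: borel_ex.
have inA_h g : inA g -> inA (h g).
  by move=> [n Ag]; exists n.+1 => /=; rewrite hK.
pose psi g := if pselect (inA g) then encode g else g.
have psiT g : inA g -> psi g = encode g by rewrite /psi; case: pselect.
have psiF g : ~ inA g -> psi g = g by rewrite /psi; case: pselect.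
have notA g : ~ inA g -> G (image_continuum g) = g.
  by move=> nA; apply: contrapT => ng; apply: nA; exists 0%N.
have h_notA g g' : inA g -> ~ inA g' -> image_continuum (encode g) <> image_continuum g'.
  move=> Ag nAg' e; apply: (nAg'); have <- : h g = g' by rewrite -[RHS](notA g' nAg') /h /= e.
  exact: inA_h Ag.
have inj : injective (@image_continuum R \o psi).
  move=> g g' /=; have [a|a] := pselect (inA g); have [b|b] := pselect (inA g').
  - rewrite !psiT // => e; by rewrite -(hK g) -(hK g') /h /= e.
  - by rewrite psiT // psiF // => /(h_notA _ _ a b).
  - by rewrite psiF // psiT // => /esym/(h_notA _ _ b a).
  - by rewrite !psiF // => e; rewrite -[LHS](notA g a) e notA.
have surj K : exists g, image_continuum (psi g) = K.
  have [[n]|nA] := pselect (inA (G K)); last by exists (G K); rewrite psiF // GK.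
  case: n => [|n] /= => [|[e An]]; first by rewrite GK.
  exists (Dc (G K)); rewrite psiT; last by exists n.
  by rewrite -[RHS]GK -[in RHS]e /h /= GK.
exists (@image_continuum R \o psi); split.
- move=> U oU; rewrite (_ : _ @^-1` U = [set g | (inA g /\ U (image_continuum (encode g))) \/
    (~ inA g /\ U (image_continuum g))]).
    have oim : open ((@image_continuum R) @^-1` U).
      exact: (continuousP _).1 (@image_continuum_continuous R) _ oU.
    apply: borel_or; [apply: (borel_and mInA)|apply: (borel_and (borel_not mInA))].
      exact: (borel_preimage (borel_continuous (@encode_continuous R)) (borel_open oim)).
    exact: borel_open.
  rewrite eqEsubset; split=> g /=.
    by have [a|a] := pselect (inA g); [rewrite psiT //; left|rewrite psiF //; right].
  by case=> -[a]; [rewrite psiT|rewrite psiF].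
- have /choice[psi' psiK] := surj.
  exists psi' => [g|K]; last exact: psiK.
  by apply: inj => /=; rewrite psiK.
- move=> g; rewrite path_imageE /= underlying_image.
  have [a|a] := pselect (inA g).
    by rewrite psiT //; exact: encode_homeomorphic.
  by rewrite psiF //; exact: homeomorphic_refl.
Qed.
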